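(* Let $r\geq 1$ and let $M\subset Q$ be a compact (boundaryless) $1$-NAIM for the $C^r$ flow $\Phi^t$ on $Q$. Assume that $E^s\in C^k$, with $0\le k\le r-1$, and that $\Phi^t$ is locally $C^k$ conjugate to the linear flow $D\Phi^t|_{E^s}$ on some neighborhood of $M\subset W^s(M)$. Then $\Phi^t$ is globally $C^k$ conjugate to $D\Phi^t|_{E^s}$; that is, there exists a $C^k$ fiber-preserving isomorphism $\varphi\colon W^s(M)\to E^s$ such that $$\forall t\in\mathbb{R}:\qquad \varphi\circ\Phi^t=D\Phi^t|_{E^s}\circ\varphi .$$ Additionally, $\varphi$ agrees with the local conjugacy on the domain of the latter.
   Context: $Q$ is a finite-dimensional $C^\infty$ Riemannian manifold with a $C^r$ vector field generating the $C^r$ flow $\Phi^t$. For a linear map $A$ put $\lfloor A\rfloor:=\inf\{\|Av\|:\|v\|=1\}$. A compact boundaryless submanifold $M\subset Q$ is a $1$-NAIM (normally attracting invariant manifold) if $\Phi^t(M)=M$ for all $t\in\mathbb{R}$ and there are a continuous $D\Phi^t$-invariant splitting $TQ|_M=TM\oplus E^s$ and constants $C>0$, $a<0$ with $\|D\Phi^t|_{E^s_m}\|\le Ce^{at}\lfloor D\Phi^t|_{T_mM}\rfloor^i$ for all $m\in M$, $t\ge0$, $i\in\{0,1\}$. Such an $M$ has a local stable manifold $W^s_{\mathrm{loc}}(M)=\coprod_{m\in M}W^s_{\mathrm{loc}}(m)$, with points asymptotic to $M$ in forward time, whose leaves are $C^r$ embedded disks with $W^s_{\mathrm{loc}}(m)\cap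 M=\{m\}$, $T_mW^s_{\mathrm{loc}}(m)=E^s_m$, depending continuously on $m$, and $\Phi^t(W^s_{\mathrm{loc}}(m))\subset W^s_{\mathrm{loc}}(\Phi^t(m))$ for $t\ge0$. Put $W^s(m):=\bigcup_{t\ge0}\Phi^{-t}(W^s_{\mathrm{loc}}(\Phi^t(m)))$ and $W^s(M):=\coprod_{m\in M}W^s(m)$, the global stable manifold (here the open basin of attraction of $M$). A $C^k$ isomorphism is a homeomorphism if $k=0$ and a $C^k$ diffeomorphism if $k\ge1$. A map from (a subset of) $W^s(M)$ to $E^s$ is fiber-preserving if it sends points of $W^s(m)$ into $E^s_m$ for every $m\in M$. ''$\Phi^t$ is locally $C^k$ conjugate to $D\Phi^t|_{E^s}$ on a neighborhood of $M$'' means: there are an open neighborhood $U$ of $M$ in $W^s(M)$ and a $C^k$ fiber-preserving isomorphism $\varphi_{\mathrm{loc}}\colon U\to\varphi_{\mathrm{loc}}(U)\subset E^s$ onto an open neighborhood of the zero section such that $\varphi_{\mathrm{loc}}\circ\Phi^t=D\Phi^t|_{E^s}\circ\varphi_{\mathrm{loc}}$ whenever both sides are defined; $\varphi_{\mathrm{loc}}$ is the local conjugacy and $U$ its domain. *)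

(* Defs.v *)
From HB Require Import structures.
From mathcomp Require Import all_boot all_order all_algebra.
From mathcomp Require Import all_classical all_reals all_analysis.

Set Implicit Arguments.
Unset Strict Implicit.
Unset Printing Implicit Defensive.

Import Order.TTheory GRing.Theory Num.Theory.
Import numFieldNormedType.Exports.

Local Open Scope classical_set_scope.
Local Open Scope ring_scope.

(* f is of class C^k on the open set O. V is meant to be finite-dimensional, so
   that C^k regularity of all directional derivatives suffices. *)
Fixpoint Ck_on (R : realType) (V W : normedModType R) (k : nat) (O : set V)
    (f : V -> W) : Prop :=
  match k with
  | 0 => forall x, O x -> {for x, continuous f}
  | k'.+1 => (forall x, O x -> differentiable f x) /\
             forall v, Ck_on k' O (fun x => 'D_v f x)
  end.

(* cfun is meaningful on cdom only, and cinv on cimg only. *)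
Record chart (T : Type) (V : Type) := Chart {
  cdom : set T ;
  cfun : T -> V ;
  cinv : V -> T }.

Definition cimg (T V : Type) (c : chart T V) : set V := cfun c @` cdom c.

(* A space with a preferred chart around each point. A differentiable atlas
   loses nothing by being reduced to one chart per point, and the preferred
   charts give the tangent space at x the model space V as carrier. *)
Record charted (R : realType) (V : normedModType R) := Charted {
  charted_space :> topologicalType ;
  chart_at : charted_space -> chart charted_space V }.

Arguments chart_at {R V c} x.

Definition euclid (R : realType) (V : normedModType R) : charted V :=
  @Charted R V V (fun=> Chart setT id id).

Definition prod_charted (R : realType) (V W : normedModType R)
    (X : charted V) (Y : charted W) : charted (V * W)%type :=
  @Charted R (V * W)%type (X * Y)%type (fun p =>
    Chart (cdom (chart_at p.1) `*` cdom (chart_at p.2))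
      (fun q => (cfun (chart_at p.1) q.1, cfun (chart_at p.2) q.2))
      (fun u => (cinv (chart_at p.1) u.1, cinv (chart_at p.2) u.2))).

(* f is of class C^k on the arbitrary subset A: continuous on A and, when
   k >= 1, locally the restriction, in charts, of a C^k map defined on an open
   set. For A a C^k submanifold this is the intrinsic notion. *)
Definition Ck_map (R : realType) (V W : normedModType R) (k : nat)
    (X : charted V) (Y : charted W) (A : set X) (f : X -> Y) : Prop :=
  {within A, continuous f} /\
  ((0 < k)%N -> forall x, A x ->
     exists (O : set V) (F : V -> W),
       [/\ open O, O (cfun (chart_at x) x), O `<=` cimg (chart_at x),
           Ck_on k O F &
           forall y, A y -> cdom (chart_at x) y -> O (cfun (chart_at x) y) ->
             cdom (chart_at (f x)) (f y) /\
             cfun (chart_at (f x)) (f y) = F (cfun (chart_at x) y)]).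

(* A C^k isomorphism of A onto B: a homeomorphism if k = 0, a C^k
   diffeomorphism if k >= 1. *)
Definition Ck_iso (R : realType) (V W : normedModType R) (k : nat)
    (X : charted V) (Y : charted W) (A : set X) (B : set Y) (f : X -> Y)
    : Prop :=
  [/\ f @` A = B, Ck_map k A f &
      exists h : Y -> X, (forall x, A x -> h (f x) = x) /\ Ck_map k B h].

(* The derivative T_x X -> T_(f x) Y, both tangent spaces being read in the
   preferred charts at x and f x. *)
Definition mdiff (R : realType) (V W : normedModType R)
    (X : charted V) (Y : charted W) (f : X -> Y) (x : X) : V -> W :=
  'd (cfun (chart_at (f x)) \o f \o cinv (chart_at x))
     (cfun (chart_at x) x).

Record manifold (R : realType) (n : nat) := Manifold {
  mspace :> charted 'rV[R]_n ;
  manifold_hausdorff : hausdorff_space mspace ;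
  manifold_countable : @second_countable mspace ;
  chart_base : forall x : mspace, cdom (chart_at x) x ;
  chart_dom_open : forall x : mspace, open (cdom (chart_at x)) ;
  chart_img_open : forall x : mspace, open (cimg (chart_at x)) ;
  chartK : forall x y : mspace, cdom (chart_at x) y ->
    cinv (chart_at x) (cfun (chart_at x) y) = y ;
  chart_continuous : forall x y : mspace, cdom (chart_at x) y ->
    {for y, continuous (cfun (chart_at x))} ;
  chart_inv_continuous : forall (x : mspace) (u : 'rV[R]_n),
    cimg (chart_at x) u -> {for u, continuous (cinv (chart_at x))} ;
  chart_smooth : forall (x y : mspace) (k : nat),
    Ck_on k (cfun (chart_at x) @` (cdom (chart_at x) `&` cdom (chart_at y)))
      (cfun (chart_at y) \o cinv (chart_at x)) }.

(* The tangent bundle. The pair (x, v) is the vector at x with coordinates v in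
   the preferred chart at x; since that chart may vary wildly with x, the
   topology is not that of the product but the one carried by the bundle
   charts. *)
Definition tangent_set (R : realType) (n : nat) (Q : manifold R n) : Type :=
  (Q * 'rV[R]_n)%type.

HB.instance Definition _ (R : realType) (n : nat) (Q : manifold R n) :=
  Choice.copy (tangent_set Q) (Q * 'rV[R]_n)%type.

Definition tangent_chart (R : realType) (n : nat) (Q : manifold R n) (x : Q)
    : chart (tangent_set Q) ('rV[R]_n * 'rV[R]_n)%type :=
  let c := chart_at x in
  Chart [set p : tangent_set Q | cdom c p.1]
    (fun p => (cfun c p.1,
       'd (cfun c \o cinv (chart_at p.1)) (cfun (chart_at p.1) p.1) p.2))
    (fun u => (cinv c u.1,
       'd (cfun (chart_at (cinv c u.1)) \o cinv c) (u.1) u.2)).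

Definition tangent_open (R : realType) (n : nat) (Q : manifold R n)
    (A : set (tangent_set Q)) : Prop :=
  forall x : Q, open [set u : 'rV[R]_n * 'rV[R]_n |
    cimg (chart_at x) u.1 /\ A (cinv (tangent_chart x) u)].

Lemma tangent_openT (R : realType) (n : nat) (Q : manifold R n) :
  @tangent_open R n Q setT.
Proof.
move=> x; have cf : continuous (@fst 'rV[R]_n 'rV[R]_n).
  by move=> u; exact: cvg_fst.
rewrite (_ : [set _ | _] = fst @^-1` cimg (chart_at x)); last first.
  by apply/seteqP; split => u //= [].
by move/continuousP: cf; apply; exact: chart_img_open.
Qed.

Lemma tangent_openI (R : realType) (n : nat) (Q : manifold R n)
    (A B : set (tangent_set Q)) :
  tangent_open A -> tangent_open B -> tangent_open (A `&` B).
Proof.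
move=> oA oB x; have := openI (oA x) (oB x); congr open.
by apply/seteqP; split => u /= => [[[? ?] [? ?]]|[? [? ?]]].
Qed.

Lemma tangent_open_bigcup (R : realType) (n : nat) (Q : manifold R n)
    (I : Type) (f : I -> set (tangent_set Q)) :
  (forall i, tangent_open (f i)) -> tangent_open (\bigcup_i f i).
Proof.
move=> of_ x; have := bigcup_open (fun i (_ : setT i) => of_ i x); congr open.
apply/seteqP; split => u /= => [[i _ [? ?]]|[? [i _ ?]]].
  by split => //; exists i.
by exists i.
Qed.

HB.instance Definition _ (R : realType) (n : nat) (Q : manifold R n) :=
  @isOpenTopological.Build (tangent_set Q) (@tangent_open R n Q)
    (@tangent_openT R n Q) (@tangent_openI R n Q) (@tangent_open_bigcup R n Q).

Definition tangent (R : realType) (n : nat) (Q : manifold R n)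
    : charted ('rV[R]_n * 'rV[R]_n)%type :=
  @Charted R ('rV[R]_n * 'rV[R]_n)%type (tangent_set Q)
    (fun p => tangent_chart p.1).

Definition tangent_map (R : realType) (n : nat) (Q : manifold R n)
    (f : Q -> Q) (p : tangent Q) : tangent Q :=
  (f p.1, mdiff f p.1 p.2).

Definition inner (R : realType) (n : nat) (G : 'M[R]_n) (v w : 'rV[R]_n) : R :=
  (v *m G *m w^T) 0 0.

(* metric x is the Gram matrix on T_x Q. Smoothness is that of the coefficients
   of the metric in each chart: cinv (tangent_chart x) (u, v) is the vector
   with coordinates v at the point with coordinates u. *)
Record riemannian (R : realType) (n : nat) (Q : manifold R n) := Riemannian {
  metric :> Q -> 'M[R]_n ;
  metric_sym : forall x, (metric x)^T = metric x ;
  metric_pos : forall x v, v != 0 -> 0 < inner (metric x) v v ;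
  metric_smooth : forall (x : Q) (v w : 'rV[R]_n) (k : nat),
    Ck_on k (cimg (chart_at x)) (fun u => inner (metric (cinv (chart_at x) u))
      (cinv (tangent_chart x) (u, v)).2
      (cinv (tangent_chart x) (u, w)).2 : R^o) }.

Definition tnorm (R : realType) (n : nat) (Q : manifold R n)
    (g : riemannian Q) (x : Q) (v : 'rV[R]_n) : R :=
  Num.sqrt (inner (g x) v v).

Section OperatorNorms.
Local Open Scope ereal_scope.

(* A is read as a linear map T_x Q -> T_y Q; its restriction to the subspace S
   has norm 0 if S = 0. *)
Definition opnorm (R : realType) (n : nat) (Q : manifold R n)
    (g : riemannian Q) (x y : Q) (S : set 'rV[R]_n)
    (A : 'rV[R]_n -> 'rV[R]_n) : \bar R :=
  ereal_sup [set (tnorm g y (A v))%:E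
            | v in [set v | S v /\ (tnorm g x v <= 1)%R]].

(* +oo if S = 0, e.g. at an equilibrium M: the infimum is then over the empty
   set. *)
Definition conorm (R : realType) (n : nat) (Q : manifold R n)
    (g : riemannian Q) (x y : Q) (S : set 'rV[R]_n)
    (A : 'rV[R]_n -> 'rV[R]_n) : \bar R :=
  ereal_inf [set (tnorm g y (A v))%:E
            | v in [set v | S v /\ tnorm g x v = 1%R]].

End OperatorNorms.

Record is_Cr_flow (R : realType) (n : nat) (Q : manifold R n) (r : nat)
    (X : Q -> 'rV[R]_n) (Phi : R -> Q -> Q) : Prop := IsCrFlow {
  field_Cr : @Ck_map R _ _ r Q (tangent Q) setT (fun x => (x, X x)) ;
  flow_Cr : @Ck_map R _ _ r (prod_charted (euclid R^o) Q) Q setT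
              (fun p => Phi p.1 p.2) ;
  flow0 : forall x, Phi 0 x = x ;
  flowD : forall s t x, Phi (s + t) x = Phi s (Phi t x) ;
  flow_generated : forall t x,
    is_derive (t : R^o) 1 (fun s => cfun (chart_at (Phi t x)) (Phi s x))
      (X (Phi t x)) }.

(* Embedded submanifolds of class C^p (p >= 1) and dimension d, by slice
   charts. *)
Definition is_submanifold (R : realType) (n : nat) (Q : manifold R n)
    (p d : nat) (M : set Q) : Prop :=
  (d <= n)%N /\
  forall m, M m -> exists (O : set 'rV[R]_n) (psi psi' : 'rV[R]_n -> 'rV[R]_n),
    [/\ [/\ open O, O (cfun (chart_at m) m), O `<=` cimg (chart_at m)
          & open (psi @` O)],
        Ck_on p O psi, Ck_on p (psi @` O) psi',
        forall u, O u -> psi' (psi u) = u &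
        forall u, O u -> (M (cinv (chart_at m) u) <->
          forall j : 'I_n, (d <= j)%N -> psi u 0 j = 0)].

(* The velocities at m of the C^1 curves in M through m. *)
Definition tangent_space (R : realType) (n : nat) (Q : manifold R n)
    (M : set Q) (m : Q) : set 'rV[R]_n :=
  [set v | exists c : R^o -> Q,
    [/\ @Ck_map R _ _ 1 (euclid R^o) Q setT c, forall s, M (c s),
        c 0 = m & @mdiff R _ _ (euclid R^o) Q c 0 1 = v]].

(* The family E of subspaces of the tangent spaces along M has, locally, frames
   of class C^k over M. *)
Definition has_Ck_frames (R : realType) (n : nat) (Q : manifold R n)
    (k : nat) (M : set Q) (E : Q -> {vspace 'rV[R]_n}) : Prop :=
  forall m, M m -> exists (N : set Q) (s : nat) (e : 'I_s -> Q -> 'rV[R]_n),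
    [/\ open N, N m,
        forall i, @Ck_map R _ _ k Q (tangent Q) (M `&` N)
                    (fun x => (x, e i x)) &
        forall x, M x -> N x -> basis_of (E x) (codom (fun i => e i x))].

(* E is of class C^k: its total space is a C^k subbundle of TQ over M; for
   k >= 1 this presupposes that the base M is C^k. *)
Definition is_Ck_subbundle (R : realType) (n : nat) (Q : manifold R n)
    (k d : nat) (M : set Q) (E : Q -> {vspace 'rV[R]_n}) : Prop :=
  ((0 < k)%N -> is_submanifold k d M) /\ has_Ck_frames k M E.

Definition total_space (R : realType) (n : nat) (Q : manifold R n)
    (M : set Q) (E : Q -> {vspace 'rV[R]_n}) : set (tangent Q) :=
  [set p : tangent Q | M p.1 /\ p.2 \in E p.1].

(* M is a compact 1-NAIM of dimension d with stable bundle E. *)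
Record is_1NAIM (R : realType) (n : nat) (Q : manifold R n)
    (g : riemannian Q) (Phi : R -> Q -> Q) (d : nat) (M : set Q)
    (E : Q -> {vspace 'rV[R]_n}) : Prop := Is1NAIM {
  naim_compact : compact M ;
  naim_submanifold : is_submanifold 1 d M ;
  naim_invariant : forall t, Phi t @` M = M ;
  naim_splitting : forall m, M m -> exists T : {vspace 'rV[R]_n},
    [/\ [set` T] = tangent_space M m, (T + E m = fullv)%VS
      & (T :&: E m = 0)%VS] ;
  naim_continuous : has_Ck_frames 0 M E ;
  naim_bundle_invariant : forall t m, M m ->
    mdiff (Phi t) m @` [set` E m] = [set` E (Phi t m)] ;
  naim_rates : exists C a : R, [/\ 0 < C, a < 0 &
    forall (m : Q) (t : R) (i : nat), M m -> 0 <= t -> (i <= 1)%N ->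
      (opnorm g m (Phi t m) [set` E m] (mdiff (Phi t) m) <=
       (C * expR (a * t))%:E *
       conorm g m (Phi t m) (tangent_space M m) (mdiff (Phi t) m) ^+ i)%E] }.

(* M being compact, entering every neighbourhood of M amounts to the distance
   to M tending to 0. *)
Definition basin (R : realType) (n : nat) (Q : manifold R n)
    (Phi : R -> Q -> Q) (M : set Q) : set Q :=
  [set x | forall V : set Q, set_nbhs M V ->
     \forall t \near +oo%R, V (Phi t x)].

Definition open_disk (R : realType) (s : nat) : set 'rV[R]_s :=
  [set v | \sum_i v 0 i ^+ 2 < 1].

Definition is_Cr_embedding (R : realType) (n : nat) (Q : manifold R n)
    (r s : nat) (D : set 'rV[R]_s) (h : 'rV[R]_s -> Q) : Prop :=
  [/\ @Ck_map R _ _ r (euclid 'rV[R]_s) Q D h,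
      forall v, D v -> injective (@mdiff R _ _ (euclid 'rV[R]_s) Q h v) &
      exists h' : Q -> 'rV[R]_s,
        (forall v, D v -> h' (h v) = v) /\ {within h @` D, continuous h'}].

(* W^s(m), the global stable leaf. *)
Definition Ws (R : realType) (n : nat) (Q : manifold R n)
    (Phi : R -> Q -> Q) (Wloc : Q -> set Q) (m : Q) : set Q :=
  \bigcup_(t in [set t : R | 0 <= t]) (Phi (- t) @` Wloc (Phi t m)).

Definition WsM (R : realType) (n : nat) (Q : manifold R n)
    (Phi : R -> Q -> Q) (M : set Q) (Wloc : Q -> set Q) : set Q :=
  \bigcup_(m in M) Ws Phi Wloc m.

(* Wloc m is the leaf through m of a local stable manifold of M. *)
Record is_local_stable_manifold (R : realType) (n : nat) (Q : manifold R n)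
    (r d : nat) (Phi : R -> Q -> Q) (M : set Q)
    (E : Q -> {vspace 'rV[R]_n}) (Wloc : Q -> set Q) : Prop :=
  IsLocalStableManifold {
  Wloc_disjoint : trivIset M Wloc ;
  Wloc_asymptotic : forall m, M m -> Wloc m `<=` basin Phi M ;
  Wloc_leaves : forall m0, M m0 ->
    exists (N : set Q) (h : Q -> 'rV[R]_(n - d) -> Q),
      [/\ open N, N m0,
          forall m, M m -> N m ->
            is_Cr_embedding r (@open_disk R (n - d)) (h m) /\
            h m @` @open_disk R (n - d) = Wloc m &
          {within (M `&` N) `*` @open_disk R (n - d),
             continuous (fun p => h p.1 p.2)}] ;
  Wloc_meet : forall m, M m -> Wloc m `&` M = [set m] ;
  Wloc_tangent : forall m, M m -> tangent_space (Wloc m) m = [set` E m] ;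
  Wloc_invariant : forall m t, M m -> 0 <= t ->
    Phi t @` Wloc m `<=` Wloc (Phi t m) ;
  WsM_open : open (WsM Phi M Wloc) ;
  WsM_basin : WsM Phi M Wloc = basin Phi M }.

Definition relatively_open (T : topologicalType) (B A : set T) : Prop :=
  exists2 O : set T, open O & A = B `&` O.

Definition fiber_preserving (R : realType) (n : nat) (Q : manifold R n)
    (Phi : R -> Q -> Q) (M : set Q) (E : Q -> {vspace 'rV[R]_n})
    (Wloc : Q -> set Q) (A : set Q) (f : Q -> tangent Q) : Prop :=
  forall m x, M m -> A x -> Ws Phi Wloc m x ->
    (f x).1 = m /\ (f x).2 \in E m.

(* phi is a local C^k conjugacy with domain U. *)
Record is_local_conjugacy (R : realType) (n : nat) (Q : manifold R n)
    (k : nat) (Phi : R -> Q -> Q) (M : set Q) (E : Q -> {vspace 'rV[R]_n})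
    (Wloc : Q -> set Q) (U : set Q) (phi : Q -> tangent Q) : Prop :=
  IsLocalConjugacy {
  conj_dom_open : relatively_open (WsM Phi M Wloc) U ;
  conj_dom_nbhs : M `<=` U ;
  conj_img_open : relatively_open (total_space M E) (phi @` U) ;
  conj_img_zero : forall m, M m -> (phi @` U) (m, 0) ;
  conj_iso : Ck_iso k U (phi @` U) phi ;
  conj_fiber : fiber_preserving Phi M E Wloc U phi ;
  conj_eq : forall t x, U x -> U (Phi t x) ->
    phi (Phi t x) = tangent_map (Phi t) (phi x) }.

(* Main.v *)
Require Import Defs.
From HB Require Import structures.
From mathcomp Require Import all_boot all_order all_algebra.
From mathcomp Require Import all_classical all_reals all_analysis.
From mathcomp Require Import lra.
Import Order.TTheory GRing.Theory Num.Theory.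
Import numFieldNormedType.Exports.
Local Open Scope classical_set_scope.
Local Open Scope ring_scope.
Set Implicit Arguments.
Unset Strict Implicit.
Unset Printing Implicit Defensive.

(** The local conjugacy [phi_loc] is spread along the flow: for [x] in the basin
    and any time [t] with [Phi t x] in [U], put
      [global_conj x := TPhi (- t) (phi_loc (Phi t x))],
    where [TPhi t] is the tangent map of [Phi t].  Such a time exists because
    the basin is the global stable manifold and [U] is an open neighbourhood of
    [M].  The value is the same for all such times ([global_conjE]), because the
    local conjugacy relation holds between any two points of [U] on one orbit;
    so the time may be chosen freely, and equivariance, agreement with
    [phi_loc] (take [t = 0]) and preservation of the fibres follow.

    Injectivity is seen at a late time, when both points have entered [U]
    ([global_conj_inj]).  Surjectivity needs every orbit of [TPhi] in the stable
    bundle to enter the image of [phi_loc], an open neighbourhood of the zero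
    section ([total_space_enters]): the vectors shrink exponentially by the
    rates of the NAIM, the base points stay in the compact set [M], and over a
    neighbourhood of a point of [M] all vectors of small Riemannian length
    belong to a given neighbourhood of the zero vector ([short_vectors_nbhs]).

    Near a given point one and the same time can be used, so [global_conj] and
    its inverse are locally composites of [phi_loc] or its inverse with [Phi t]
    and [TPhi t].  The flow is C^r and its tangent flow is C^(r-1)
    ([tangent_map_Ck_rep]); as [k <= r - 1], the composites are C^k.  Most of
    the text builds what this last argument takes for granted: composition of
    C^k maps, first between vector spaces ([Ck_on_comp]), then in charts
    ([Ck_map_comp]), the charts of the tangent bundle ([tangent_atlas]) and the
    regularity of tangent maps. *)

(** * C^k maps between finite-dimensional spaces *)

Section Calculus.
Context {R : realType}.
Implicit Types U V W Z : normedModType R.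

(** The differential is characterized by a first-order expansion, which only
    involves the germ of the map. *)
Lemma near_eq_diff V W (f g : V -> W) (x : V) :
  (\near x, f x = g x) -> differentiable f x ->
  differentiable g x /\ 'd g x = 'd f x :> (V -> W).
Proof.
move=> fg df.
have /diff_locallyP [dfc dfx] := df.
have gx : g \o shift x = cst (g x) + 'd f x +o_ 0 id.
  apply/eqaddoP => e e0.
  move/eqaddoP: dfx => /(_ e e0).
  have : \forall h \near (0 : V), f (h + x) = g (h + x).
    by move: fg; rewrite (near_shift 0 x)/= subr0.
  apply: filterS2 => h /= fgh.
  by rewrite /= !fctE /= fgh (nbhs_singleton fg).
have e := diff_unique dfc gx.
split; last exact: e.
apply/diff_locallyP; split; rewrite e; [exact: dfc|exact: gx].
Qed.

Lemma Ck_on_sub V W k (O O' : set V) (f : V -> W) :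
  O' `<=` O -> Ck_on k O f -> Ck_on k O' f.
Proof.
elim: k f => [|k IH] f sO /=; first by move=> h x /sO; exact: h.
by move=> [df Df]; split=> [x /sO|v]; [exact: df|exact: IH].
Qed.

Lemma near_open_eq V W (O : set V) (f g : V -> W) x :
  open O -> (forall x, O x -> f x = g x) -> O x -> \near x, f x = g x.
Proof.
by move=> oO fg Ox; apply: filterS (open_nbhs_nbhs (conj oO Ox)).
Qed.

Lemma Ck_on_ext V W k (O : set V) (f g : V -> W) :
  open O -> (forall x, O x -> f x = g x) -> Ck_on k O f -> Ck_on k O g.
Proof.
move=> oO; elim: k f g => [|k IH] f g fg /=.
  move=> cf x Ox; have nfg := near_open_eq oO fg Ox.
  suff : g y @[y --> x] --> g x by [].
  rewrite -(fg x Ox); apply: cvg_trans (cf x Ox).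
  by apply: near_eq_cvg; apply: filterS nfg => y ->.
move=> [df Df]; split=> [x Ox|v].
  by have [] := near_eq_diff (near_open_eq oO fg Ox) (df x Ox).
apply: IH (Df v) => x Ox.
by apply: near_eq_derive; exact: near_open_eq fg Ox.
Qed.

Lemma Ck_on_pred V W k (O : set V) (f : V -> W) :
  Ck_on k.+1 O f -> Ck_on k O f.
Proof.
elim: k f => [|k IH] f.
  by move=> [df _] x Ox; apply: differentiable_continuous; exact: df.
by move=> [df Df]; split=> [//|v]; exact: IH (Df v).
Qed.

Lemma Ck_on_le V W k l (O : set V) (f : V -> W) :
  (k <= l)%N -> Ck_on l O f -> Ck_on k O f.
Proof.
move=> /subnK <-; elim: (l - k)%N => [//|m IH].
by rewrite addSn => /Ck_on_pred.
Qed.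

Lemma Ck_on_continuous V W k (O : set V) (f : V -> W) x :
  Ck_on k O f -> O x -> {for x, continuous f}.
Proof. by move/(@Ck_on_le V W 0 k O f (leq0n k)) => h; exact: h. Qed.

Lemma Ck_on_cst V W k (O : set V) (w : W) : Ck_on k O (fun=> w).
Proof.
elim: k w => [|k IH] w /=.
  by move=> x _; apply: cst_continuous.
split=> [x _|v]; first exact: differentiable_cst.
have -> : (fun x => 'D_v (fun=> w) x) = (fun=> 0) :> (V -> W).
  by apply/funext => x; exact: derive_cst.
exact: IH.
Qed.

Lemma Ck_on_add V W k (O : set V) (f g : V -> W) :
  open O -> Ck_on k O f -> Ck_on k O g -> Ck_on k O (fun x => f x + g x).
Proof.
move=> oO; elim: k f g => [|k IH] f g /=.
  by move=> cf cg x Ox; apply: cvgD; [exact: cf|exact: cg].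
move=> [df Df] [dg Dg]; split=> [x Ox|v].
  by apply: differentiableD; [exact: df|exact: dg].
apply: Ck_on_ext (IH _ _ (Df v) (Dg v)) => // x Ox; apply/esym.
by apply: deriveD; apply: diff_derivable; [exact: df|exact: dg].
Qed.

Lemma Ck_on_sum V W k (O : set V) s (f : 'I_s -> V -> W) :
  open O -> (forall i, Ck_on k O (f i)) -> Ck_on k O (fun x => \sum_i f i x).
Proof.
move=> oO Cf.
suff : forall l : seq 'I_s, Ck_on k O (fun x => \sum_(i <- l) f i x).
  exact.
elim=> [|i l IH].
  by apply: Ck_on_ext (Ck_on_cst k O 0) => // x _; rewrite big_nil.
by apply: Ck_on_ext (Ck_on_add oO (Cf i) IH) => // x _; rewrite big_cons.
Qed.

Lemma Ck_on_linear V W k (O : set V) (f : {linear V -> W}) :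
  continuous f -> Ck_on k O f.
Proof.
move=> cf; case: k => [|k] /=; first by move=> x _; exact: cf.
split=> [x _|v]; first exact: linear_differentiable.
have -> : (fun x => 'D_v f x) = (fun=> f v) :> (V -> W).
  apply/funext => x; rewrite deriveE ?diff_lin //.
  exact: linear_differentiable.
exact: Ck_on_cst.
Qed.

Lemma Ck_on_linear_comp U V W k (O : set U) (g : {linear V -> W}) (f : U -> V) :
  continuous g -> open O -> Ck_on k O f -> Ck_on k O (g \o f).
Proof.
move=> cg oO; elim: k f => [|k IH] f /=.
  by move=> cf x Ox; apply: continuous_comp; [exact: cf|exact: cg].
move=> [df Df]; split=> [x Ox|v].
  by apply: differentiable_comp; [exact: df|exact: linear_differentiable].
apply: Ck_on_ext (IH _ (Df v)) => // x Ox /=.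
have dg : differentiable g (f x) by exact: linear_differentiable.
rewrite (deriveE v (df x Ox)) (deriveE v (differentiable_comp (df x Ox) dg)).
by rewrite (diff_comp (df x Ox) dg) /= diff_lin.
Qed.

Fact scale_is_bilinear W :
  bilinear_for (GRing.Scale.Law.clone _ _ *:%R _) (GRing.Scale.Law.clone _ _ *:%R _)
    (fun (a : R^o) (w : W) => a *: w).
Proof.
split=> [w a u v|a b u v] /=.
  by rewrite scalerDl scalerA.
by rewrite scalerDr !scalerA mulrC.
Qed.

Lemma is_diff_scale V W (a : V -> R^o) (f : V -> W) x :
  differentiable a x -> differentiable f x ->
  is_diff x (fun y => a y *: f y)
    (fun v => a x *: 'd f x v + 'd a x v *: f x).
Proof.
move=> da df.
pose bM := bilinear_isBilinear.Build R R^o W W _ _ _ (@scale_is_bilinear W).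
pose b : {bilinear R^o -> W -> W} := HB.pack (fun (a : R^o) (w : W) => a *: w) bM.
have cb : continuous (fun p : R^o * W => b p.1 p.2).
  by move=> p; apply: scale_continuous.
have db := @differentiable_bilin _ _ _ _ b (a x, f x) cb.
have dp := differentiable_pair da df.
have e : (fun y => a y *: f y) = (fun p => b p.1 p.2) \o (fun y => (a y, f y)) by [].
split; first by rewrite e; exact: differentiable_comp.
by rewrite e diff_comp // diff_pair // diff_bilin.
Qed.

Lemma Ck_on_scale V W k (O : set V) (a : V -> R^o) (f : V -> W) :
  open O -> Ck_on k O a -> Ck_on k O f -> Ck_on k O (fun x => a x *: f x).
Proof.
move=> oO; elim: k a f => [|k IH] a f /=.
  by move=> ca cf x Ox; apply: cvgZ; [exact: ca|exact: cf].
move=> [da Da] [df Df]; split=> [x Ox|v].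
  by have [] := is_diff_scale (da x Ox) (df x Ox).
have Ca : Ck_on k O a by apply: Ck_on_pred; split.
have Cf : Ck_on k O f by apply: Ck_on_pred; split.
apply: Ck_on_ext (Ck_on_add oO (IH _ _ Ca (Df v)) (IH _ _ (Da v) Cf)) => // x Ox.
have [ds es] := is_diff_scale (da x Ox) (df x Ox).
by rewrite (deriveE v ds) es (deriveE v (da x Ox)) (deriveE v (df x Ox)).
Qed.

(** Finite dimension, in the form that the chain rule for [Ck_on] uses: vectors
    are expanded along a basis with continuous coordinates. *)
Definition finite_coords W : Prop :=
  exists (s : nat) (e : 'I_s -> W) (l : 'I_s -> {linear W -> R^o}),
    (forall i, continuous (l i)) /\ forall w, w = \sum_i l i w *: e i.

(** [Ck_on] differentiates along fixed vectors, whereas the direction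
    ['D_v f x] in which [g] is differentiated moves with [x].  Expanded in
    coordinates, the derivative of the composite becomes a sum of products of
    maps to which the induction hypothesis applies. *)
Lemma Ck_on_comp U V W k (O : set U) (O' : set V) (f : U -> V) (g : V -> W) :
  finite_coords V -> open O -> (forall x, O x -> O' (f x)) ->
  Ck_on k O f -> Ck_on k O' g -> Ck_on k O (g \o f).
Proof.
move=> [s [e [l [cl coord]]]] oO fO; elim: k f g fO => [|k IH] f g fO.
  move=> cf cg x Ox; apply: continuous_comp; first exact: cf.
  by apply: cg; exact: fO.
move=> Cf Cg; have [df Df] := Cf; have [dg Dg] := Cg.
split=> [x Ox|v].
  by apply: differentiable_comp; [exact: df|exact/dg/fO].
have Cf' := Ck_on_pred Cf.
(* 'D_v (g \o f) x = \sum_i l_i ('D_v f x) *: 'D_(e_i) g (f x) *)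
apply: (@Ck_on_ext _ _ _ _
  (fun x => \sum_i (l i \o (fun x => 'D_v f x)) x *: ('D_(e i) g \o f) x)) => //.
  move=> x Ox; have dfx := df x Ox; have dgx := dg _ (fO x Ox).
  rewrite (deriveE v (differentiable_comp dfx dgx)) (diff_comp dfx dgx) /=.
  rewrite -(deriveE v dfx) [in RHS](coord ('D_v f x)) linear_sum.
  by apply: eq_bigr => i _; rewrite linearZ /= (deriveE (e i) dgx).
apply: Ck_on_sum => // i; apply: Ck_on_scale => //.
  by apply: Ck_on_linear_comp => //; exact: Df.
by apply: IH => //; exact: Dg.
Qed.

Lemma finite_coords_rV n : finite_coords 'rV[R]_n.
Proof.
have lin i : linear (fun v : 'rV[R]_n => v 0 i : R^o).
  by move=> a u v; rewrite !mxE.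
pose l i : {linear 'rV[R]_n -> R^o} :=
  HB.pack (fun v : 'rV[R]_n => v 0 i : R^o) (GRing.isLinear.Build _ _ _ _ _ (lin i)).
exists n, (fun i => delta_mx 0 i), l; split=> [i|w]; last exact: row_sum_delta.
exact: coord_continuous.
Qed.

Lemma finite_coords_scalar : finite_coords R^o.
Proof.
exists 1%N, (fun=> 1), (fun=> idfun); split=> [i x|w]; first exact.
by rewrite big_ord1 /= [RHS]mulr1.
Qed.

(** The injections are named so as to carry linear structures: the pairing of
    two maps is then a sum of linear images of them. *)
Definition inlv V W (v : V) : V * W := (v, 0).
Definition inrv V W (w : W) : V * W := (0, w).

Fact inlv_is_linear V W : linear (@inlv V W).
Proof. by move=> a u v; congr pair; rewrite /= scaler0 addr0. Qed.

Fact inrv_is_linear V W : linear (@inrv V W).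
Proof. by move=> a u v; congr pair; rewrite /= scaler0 addr0. Qed.

HB.instance Definition _ V W :=
  GRing.isLinear.Build R V (V * W)%type _ (@inlv V W) (@inlv_is_linear V W).
HB.instance Definition _ V W :=
  GRing.isLinear.Build R W (V * W)%type _ (@inrv V W) (@inrv_is_linear V W).

Lemma inlv_continuous V W : continuous (@inlv V W).
Proof. by move=> v; apply: cvg_pair; [exact: cvg_id|exact: cvg_cst]. Qed.

Lemma inrv_continuous V W : continuous (@inrv V W).
Proof. by move=> v; apply: cvg_pair; [exact: cvg_cst|exact: cvg_id]. Qed.

Lemma inlvDinrv V W (v : V) (w : W) : (v, w) = inlv W v + inrv V w.
Proof. by congr pair; rewrite /= ?addr0 ?add0r. Qed.

Lemma finite_coords_prod V W :
  finite_coords V -> finite_coords W -> finite_coords (V * W)%type.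
Proof.
move=> [s [e [l [cl coordV]]]] [s' [e' [l' [cl' coordW]]]].
pose ee (i : 'I_(s + s')) : V * W :=
  match fintype.split i with inl i => inlv W (e i) | inr i => inrv V (e' i) end.
have lin1 j : linear (fun p : V * W => l j p.1) by move=> a u v; rewrite linearP.
have lin2 j : linear (fun p : V * W => l' j p.2) by move=> a u v; rewrite linearP.
pose l1 j : {linear (V * W)%type -> R^o} :=
  HB.pack (fun p : V * W => l j p.1) (GRing.isLinear.Build _ _ _ _ _ (lin1 j)).
pose l2 j : {linear (V * W)%type -> R^o} :=
  HB.pack (fun p : V * W => l' j p.2) (GRing.isLinear.Build _ _ _ _ _ (lin2 j)).
pose ll (i : 'I_(s + s')) :=
  match fintype.split i with inl i => l1 i | inr i => l2 i end.
exists (s + s')%N, ee, ll; split=> [i|[v w]].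
  rewrite /ll; case: (fintype.split i) => j p; apply: continuous_comp.
  - exact: cvg_fst.
  - exact: cl.
  - exact: cvg_snd.
  - exact: cl'.
rewrite big_split_ord /= /ll /ee [LHS]inlvDinrv.
rewrite [in LHS](coordV v) [in LHS](coordW w) !linear_sum.
congr (_ + _); apply: eq_bigr => i _.
  by rewrite (unsplitK (inl _)) linearZ.
by rewrite (unsplitK (inr _)) linearZ.
Qed.

Lemma Ck_on_pair U V W k (O : set U) (f : U -> V) (g : U -> W) :
  open O -> Ck_on k O f -> Ck_on k O g -> Ck_on k O (fun x => (f x, g x)).
Proof.
move=> oO Cf Cg.
apply: (@Ck_on_ext _ _ _ _ (fun x => (@inlv V W \o f) x + (@inrv V W \o g) x)) => //.
  by move=> x _; rewrite inlvDinrv.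
by apply: Ck_on_add => //; apply: Ck_on_linear_comp => //;
  [exact: inlv_continuous|exact: inrv_continuous].
Qed.

Lemma open_setXT V W (O : set V) : open O -> open (O `*` [set: W]).
Proof.
move=> oO; rewrite (_ : _ `*` _ = fst @^-1` O); last first.
  by apply/seteqP; split=> [[u w] []|[u w]].
have /continuousP cf : continuous (@fst V W) by move=> u; exact: cvg_fst.
exact: cf.
Qed.

Lemma Ck_on_fst V W k (O : set (V * W)) : Ck_on k O fst.
Proof. by apply: (@Ck_on_linear _ _ _ _ fst) => p; exact: cvg_fst. Qed.

Lemma Ck_on_snd V W k (O : set (V * W)) : Ck_on k O snd.
Proof. by apply: (@Ck_on_linear _ _ _ _ snd) => p; exact: cvg_snd. Qed.

(** As a function of point and vector together the differential loses only one
    derivative: it is linear in the vector, hence a sum of coordinates of the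
    vector times partial derivatives at the point. *)
Lemma Ck_on_diff V W k (O : set V) (f : V -> W) :
  finite_coords V -> open O -> Ck_on k.+1 O f ->
  Ck_on k (O `*` setT) (fun p : V * V => 'd f (p.1) p.2).
Proof.
move=> fV oO Cf; have [df Df] := Cf.
have oOT := @open_setXT V V O oO.
have fVV := finite_coords_prod fV fV.
have [s [e [l [cl coord]]]] := fV.
apply: (@Ck_on_ext _ _ _ _
  (fun p : V * V => \sum_i (l i \o snd) p *: ('D_(e i) f \o fst) p)) => //.
  move=> [u w] [/= Ou _]; rewrite [in RHS](coord w) linear_sum.
  by apply: eq_bigr => i _; rewrite linearZ /= (deriveE (e i) (df u Ou)).
apply: Ck_on_sum => // i; apply: Ck_on_scale => //.
  by apply: Ck_on_linear_comp => //; exact: Ck_on_snd.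
apply: (@Ck_on_comp _ _ _ _ _ O) => //; [by move=> ? []|exact: Ck_on_fst|exact: Df].
Qed.

End Calculus.

(** * C^k maps in charts *)

Section Charted.
Context {R : realType}.

(** The condition that [Ck_map] imposes at one point, here at every order
    including 0.  On the whole space, order 0 amounts to continuity read in
    charts, see [Ck_rep_continuous]. *)
Definition Ck_rep (V W : normedModType R) (k : nat) (X : charted V)
    (Y : charted W) (A : set X) (f : X -> Y) (x : X) : Prop :=
  exists (O : set V) (F : V -> W),
    [/\ open O, O (cfun (chart_at x) x), O `<=` cimg (chart_at x),
        Ck_on k O F &
        forall y, A y -> cdom (chart_at x) y -> O (cfun (chart_at x) y) ->
          cdom (chart_at (f x)) (f y) /\
          cfun (chart_at (f x)) (f y) = F (cfun (chart_at x) y)].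

(** What the charts of a manifold and those of its tangent bundle have in common
    topologically; the statements on C^k maps below apply to both. *)
Record is_atlas (V : normedModType R) (X : charted V) : Prop := IsAtlas {
  atlas_base : forall x : X, cdom (chart_at x) x ;
  atlas_dom_open : forall x : X, open (cdom (chart_at x)) ;
  atlas_img_open : forall x : X, open (cimg (chart_at x)) ;
  atlasK : forall x y : X, cdom (chart_at x) y ->
    cinv (chart_at x) (cfun (chart_at x) y) = y ;
  atlas_continuous : forall x y : X, cdom (chart_at x) y ->
    {for y, continuous (cfun (chart_at x))} ;
  atlas_inv_continuous : forall (x : X) (u : V),
    cimg (chart_at x) u -> {for u, continuous (cinv (chart_at x))} }.

Lemma manifold_atlas n (Q : manifold R n) : is_atlas Q.
Proof.
split; [exact: chart_base|exact: chart_dom_open|exact: chart_img_open|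
  exact: chartK|exact: chart_continuous|exact: chart_inv_continuous].
Qed.

Lemma open_setI_preimage (S T : topologicalType) (f : S -> T) (D : set S)
    (O : set T) :
  open D -> (forall x, D x -> {for x, continuous f}) -> open O ->
  open (D `&` f @^-1` O).
Proof.
move=> oD cf oO; rewrite openE => x [Dx Ofx]; apply: filterI.
  exact: (open_nbhs_nbhs (conj oD Dx)).
exact: (cf x Dx _ (open_nbhs_nbhs (conj oO Ofx))).
Qed.

Lemma within_continuousP (S T : topologicalType) (A : set S) (f : S -> T) :
  {within A, continuous f} <->
  forall x, A x -> forall N, nbhs (f x) N ->
    exists O, [/\ open O, O x & forall y, A y -> O y -> N (f y)].
Proof.
split=> [/subspace_continuousP cf x Ax N /(cf x Ax)|cf].
  rewrite /= /nbhs /= /within /= => /nbhs_interior.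
  move=> h; exists ((fun y => A y -> N (f y))°); split.
  - exact: open_interior.
  - exact: nbhs_singleton h.
  - by move=> y Ay /nbhs_singleton; exact.
apply/subspace_continuousP => x Ax N /(cf x Ax) [ O [oO Ox ON]].
apply: filterS (open_nbhs_nbhs (conj oO Ox)) => y Oy Ay; exact: ON.
Qed.

Lemma within_continuous_compose (S T P : topologicalType) (A : set S)
    (B : set T) (f : S -> T) (g : T -> P) :
  (forall x, A x -> B (f x)) -> {within A, continuous f} ->
  {within B, continuous g} -> {within A, continuous (g \o f)}.
Proof.
move=> AB /within_continuousP cf /within_continuousP cg.
apply/within_continuousP => x Ax N /(cg _ (AB x Ax)) [ O [oO Ofx ON]].
have [ O' [oO' O'x O'O]] := cf x Ax _ (open_nbhs_nbhs (conj oO Ofx)).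
by exists O'; split => // y Ay O'y; apply: ON; [exact: AB|exact: O'O].
Qed.

Lemma within_continuous_local (S T : topologicalType) (A : set S) (f : S -> T) :
  (forall x, A x -> exists (N : set S) (g : S -> T),
    [/\ open N, N x, forall y, A y -> N y -> f y = g y &
        {within A `&` N, continuous g}]) -> {within A, continuous f}.
Proof.
move=> in_charts; apply/within_continuousP => x Ax P.
have [N [g [oN Nx fg /within_continuousP cg]]] := in_charts x Ax.
rewrite (fg x Ax Nx) => /(cg x (conj Ax Nx)) [ O [oO Ox OP]].
exists (O `&` N); split; [exact: openI|by []|].
by move=> y Ay [Oy Ny]; rewrite fg //; exact: OP.
Qed.

Section Maps.
Context {V W Z : normedModType R}.
Implicit Types (X : charted V) (Y : charted W) (T : charted Z).

Lemma Ck_rep_le k l X Y (A : set X) (f : X -> Y) x :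
  (k <= l)%N -> Ck_rep l A f x -> Ck_rep k A f x.
Proof.
move=> kl [ O [F [oO Ox OX CF rF]]]; exists O, F; split=> //.
exact: Ck_on_le CF.
Qed.

Lemma Ck_rep_sub k X Y (A B : set X) (f : X -> Y) x :
  A `<=` B -> Ck_rep k B f x -> Ck_rep k A f x.
Proof.
move=> AB [ O [F [oO Ox OX CF rF]]]; exists O, F; split=> // y Ay.
by apply: rF; exact: AB.
Qed.

(** The preferred chart at [f x] is both the target chart of [f] and the source
    chart of [g], so the local representatives compose without any change of
    charts. *)
Lemma Ck_rep_comp k X Y T (A : set X) (B : set Y) (f : X -> Y) (g : Y -> T) x :
  finite_coords V -> finite_coords W -> cdom (chart_at x) x ->
  A x -> (forall x, A x -> B (f x)) ->
  Ck_rep k A f x -> Ck_rep k B g (f x) -> Ck_rep k A (g \o f) x.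
Proof.
move=> fV fW dx Ax AB [ O [F [oO Ox OX CF rF]]] [ O' [G [oO' O'x OX' CG rG]]].
have [dfx Fx] := rF x Ax dx Ox.
exists (O `&` F @^-1` O'), (G \o F); split.
- by apply: open_setI_preimage => // u Ou; exact: Ck_on_continuous CF Ou.
- by split=> //=; rewrite -Fx.
- by move=> u [/OX].
- apply: (@Ck_on_comp _ _ _ _ _ _ O') CG => //.
  + by apply: open_setI_preimage => // u Ou; exact: Ck_on_continuous CF Ou.
  + by move=> u [].
  + by apply: Ck_on_sub CF => u [].
- move=> y Ay dy [Oy O'y]; have [dfy Fy] := rF y Ay dy Oy.
  have O'fy : O' (cfun (chart_at (f x)) (f y)) by rewrite Fy.
  by have [? ->] := rG (f y) (AB y Ay) dfy O'fy; split=> //=; rewrite Fy.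
Qed.

Lemma Ck_map_comp k X Y T (A : set X) (B : set Y) (f : X -> Y) (g : Y -> T) :
  finite_coords V -> finite_coords W -> (forall x : X, cdom (chart_at x) x) ->
  (forall x, A x -> B (f x)) -> Ck_map k A f -> Ck_map k B g ->
  Ck_map k A (g \o f).
Proof.
move=> fV fW dX AB [cf Cf] [cg Cg]; split.
  exact: within_continuous_compose AB cf cg.
by move=> k0 x Ax; apply: (Ck_rep_comp _ _ _ _ AB) => //;
  [exact: Cf|exact/Cg/AB].
Qed.

Lemma Ck_map_sub k X Y (A B : set X) (f : X -> Y) :
  A `<=` B -> Ck_map k B f -> Ck_map k A f.
Proof.
move=> AB [cf Cf]; split; first exact: continuous_subspaceW cf.
by move=> k0 x /AB Bx; apply: Ck_rep_sub AB _; exact: Cf.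
Qed.

(** For maps given near each point by a formula of their own: in the sequel, a
    formula with a time that depends on the point. *)
Lemma Ck_map_local k X Y (A : set X) (f : X -> Y) :
  is_atlas X ->
  (forall x, A x -> exists (N : set X) (g : X -> Y),
    [/\ open N, N x, forall y, A y -> N y -> f y = g y &
        Ck_map k (A `&` N) g]) -> Ck_map k A f.
Proof.
move=> aX in_charts; split.
  apply: within_continuous_local => x /in_charts[N [g [oN Nx fg [cg _]]]].
  by exists N, g.
move=> k0 x Ax; have [N [g [oN Nx fg [_ Cg]]]] := in_charts x Ax.
have [ O [F [oO Ox OX CF rF]]] := Cg k0 x (conj Ax Nx).
have dx := atlas_base aX x.
exists (O `&` cinv (chart_at x) @^-1` N), F; split.
- apply: open_setI_preimage => // u /OX; exact: atlas_inv_continuous.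
- by split=> //=; rewrite atlasK.
- by move=> u [/OX].
- by apply: Ck_on_sub CF => u [].
- move=> y Ay dy [Oy]; rewrite /= atlasK // => Ny.
  by rewrite (fg x) // (fg y) //; exact: rF.
Qed.

(** The tangent bundle has a topology defined by its charts; continuity of maps
    between tangent bundles is obtained here. *)
Lemma Ck_rep_continuous k X Y (f : X -> Y) x :
  is_atlas X -> is_atlas Y -> Ck_rep k setT f x -> {for x, continuous f}.
Proof.
move=> aX aY [ O [F [oO Ox OX CF rF]]].
have dx := atlas_base aX x.
have [dfx Fx] := rF x I dx Ox.
have near_rep : \forall y \near x,
    cinv (chart_at (f x)) (F (cfun (chart_at x) y)) = f y.
  have cx := atlas_continuous aX dx.
  near=> y.
  have dy : cdom (chart_at x) y.
    by near: y; apply: open_nbhs_nbhs; split=> //; exact: atlas_dom_open.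
  have Oy : O (cfun (chart_at x) y).
    by near: y; apply: cx; exact: open_nbhs_nbhs.
  by have [dfy <-] := rF y I dy Oy; rewrite atlasK.
suff : f y @[y --> x] --> f x by [].
rewrite -(nbhs_singleton near_rep).
apply: cvg_trans (near_eq_cvg near_rep) _.
apply: (@continuous_comp _ _ _ (F \o cfun (chart_at x)) (cinv (chart_at (f x)))).
  apply: continuous_comp; first exact: atlas_continuous.
  exact: Ck_on_continuous CF Ox.
rewrite /= -Fx; apply: atlas_inv_continuous => //.
by exists (f x).
Unshelve. all: by end_near.
Qed.

End Maps.
End Charted.

(** * The charts of the tangent bundle *)

Section Tangent.
Local Opaque diff.
Context {R : realType} {n : nat}.
Implicit Types Q : manifold R n.

Definition in_charts Q (a b : Q) (f : Q -> Q) : 'rV[R]_n -> 'rV[R]_n :=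
  cfun (chart_at b) \o f \o cinv (chart_at a).

Lemma near_chart_inv Q (a x : Q) (P : set Q) :
  cdom (chart_at a) x -> nbhs x P ->
  \forall u \near cfun (chart_at a) x, P (cinv (chart_at a) u).
Proof.
move=> ax; rewrite -{1}(chartK ax) => Px.
by apply: (chart_inv_continuous (x := a)) Px; exists x.
Qed.

Lemma near_chart_fun Q (a x : Q) (P : set 'rV[R]_n) :
  cdom (chart_at a) x -> nbhs (cfun (chart_at a) x) P ->
  nbhs x (cfun (chart_at a) @^-1` P).
Proof. by move=> ax; exact: chart_continuous. Qed.

Lemma near_chart_dom Q (a x : Q) :
  cdom (chart_at a) x -> nbhs x (cdom (chart_at a)).
Proof. by move=> ax; apply: open_nbhs_nbhs; split=> //; exact: chart_dom_open. Qed.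

(** By continuity [f] keeps a neighbourhood of [x] inside the middle chart, which
    therefore cancels; what remains is the chain rule. *)
Lemma in_charts_comp Q (a b c : Q) (f g : Q -> Q) (x : Q) :
  cdom (chart_at a) x -> cdom (chart_at b) (f x) -> {for x, continuous f} ->
  differentiable (in_charts a b f) (cfun (chart_at a) x) ->
  differentiable (in_charts b c g) (cfun (chart_at b) (f x)) ->
  differentiable (in_charts a c (g \o f)) (cfun (chart_at a) x) /\
  forall v, 'd (in_charts a c (g \o f)) (cfun (chart_at a) x) v =
    'd (in_charts b c g) (cfun (chart_at b) (f x))
      ('d (in_charts a b f) (cfun (chart_at a) x) v).
Proof.
move=> ax bfx cf df dg.
have e : in_charts a b f (cfun (chart_at a) x) = cfun (chart_at b) (f x).
  by rewrite /in_charts /= chartK.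
rewrite -e in dg *.
have [||dgf egf] := @near_eq_diff _ _ _ (in_charts b c g \o in_charts a b f)
    (in_charts a c (g \o f)) (cfun (chart_at a) x); last 1 first.
- split; first exact: dgf.
  move=> v.
  apply: etrans (congr1 (fun h => h v) egf) _.
  exact: (congr1 (fun h => h v) (diff_comp df dg)).
- have : nbhs x (f @^-1` cdom (chart_at b)) by apply: cf; exact: near_chart_dom.
by move/(near_chart_inv ax); apply: filterS => u fu; rewrite /in_charts /= chartK.
- exact: differentiable_comp.
Qed.

Lemma transition_dom_open Q (a b : Q) :
  open (cfun (chart_at a) @` (cdom (chart_at a) `&` cdom (chart_at b))).
Proof.
rewrite (_ : _ @` _ =
    cimg (chart_at a) `&` cinv (chart_at a) @^-1` cdom (chart_at b)); last first.
  apply/seteqP; split=> [_ [x [ax bx] <-]|_ [[x ax <-]]]; rewrite /= chartK //.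
    by split=> //; exists x.
  by move=> bx; exists x.
apply: open_setI_preimage; [exact: chart_img_open| |exact: chart_dom_open].
by move=> u; exact: chart_inv_continuous.
Qed.

Lemma transition_differentiable Q (a b x : Q) :
  cdom (chart_at a) x -> cdom (chart_at b) x ->
  differentiable (in_charts a b id) (cfun (chart_at a) x).
Proof.
by move=> ax bx; have [+ _] := chart_smooth a b 1; apply; exists x.
Qed.

Lemma transition_diff_self Q (a x : Q) v :
  cdom (chart_at a) x -> 'd (in_charts a a id) (cfun (chart_at a) x) v = v.
Proof.
move=> ax; have [] := @near_eq_diff _ _ _ idfun (in_charts a a id) (cfun (chart_at a) x).
- have imx : cimg (chart_at a) (cfun (chart_at a) x) by exists x.
  apply: filterS (open_nbhs_nbhs (conj (@chart_img_open _ _ _ a) imx)).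
  by move=> _ [y ay <-]; rewrite /in_charts /= chartK.
- by apply: (@linear_differentiable _ _ _ idfun) => u.
- move=> _ e; apply: etrans (congr1 (fun h => h v) e) _.
  exact: (congr1 (fun h => h v) (@diff_lin _ _ _ idfun _ (fun u => cvg_id))).
Qed.

(** The cocycle rule for changes of charts.  Tangent vectors are stored in the
    preferred chart of their own base point, and every computation in a bundle
    chart eliminates that chart by this rule. *)
Lemma transition_diff_comp Q (a b c x : Q) v :
  cdom (chart_at a) x -> cdom (chart_at b) x -> cdom (chart_at c) x ->
  'd (in_charts b c id) (cfun (chart_at b) x) ('d (in_charts a b id) (cfun (chart_at a) x) v)
  = 'd (in_charts a c id) (cfun (chart_at a) x) v.
Proof.
move=> ax bx cx.
have cid : {for x, continuous (@id Q)} by move=> ?.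
have [_ e] := in_charts_comp ax bx cid (transition_differentiable ax bx)
  (transition_differentiable bx cx).
exact/esym/(e v).
Qed.

Lemma tangent_chartK Q (x : Q) (p : tangent Q) :
  cdom (chart_at x) p.1 ->
  cinv (tangent_chart x) (cfun (tangent_chart x) p) = p.
Proof.
case: p => q v /= xq; rewrite chartK //; congr pair.
have qq := chart_base q.
exact: etrans (transition_diff_comp v qq xq qq) (transition_diff_self v qq).
Qed.

Lemma tangent_chart_invK Q (x : Q) (u w : 'rV[R]_n) :
  cimg (chart_at x) u ->
  cfun (tangent_chart x) (cinv (tangent_chart x) (u, w)) = (u, w).
Proof.
move=> [q xq <-] /=; rewrite chartK //; congr pair.
have qq := chart_base q.
exact: etrans (transition_diff_comp w xq qq xq) (transition_diff_self w xq).
Qed.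

Lemma tangent_chart_img Q (x : Q) :
  cimg (tangent_chart x) = cimg (chart_at x) `*` setT.
Proof.
apply/seteqP; split=> [_ [[q v] xq <-]|[u w] [xu _]].
  by split=> //; exists q.
exists (cinv (tangent_chart x) (u, w)); last exact: tangent_chart_invK.
by move: xu => /= -[q xq <-]; rewrite chartK.
Qed.

Definition transition_tangent Q (a b : Q) (p : 'rV[R]_n * 'rV[R]_n) :=
  (in_charts a b id p.1, 'd (in_charts a b id) (p.1) p.2).

Lemma transition_tangentE Q (a b : Q) (u w : 'rV[R]_n) :
  cimg (chart_at a) u -> cdom (chart_at b) (cinv (chart_at a) u) ->
  cfun (tangent_chart b) (cinv (tangent_chart a) (u, w)) =
    transition_tangent a b (u, w).
Proof.
move=> [q aq <-] /=; rewrite chartK // => bq; rewrite /transition_tangent /=.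
have qq := chart_base q.
congr pair; first by rewrite /in_charts /= chartK.
exact: transition_diff_comp aq qq bq.
Qed.

Lemma transition_tangent_Ck Q (a b : Q) k :
  Ck_on k ((cfun (chart_at a) @` (cdom (chart_at a) `&` cdom (chart_at b)))
    `*` setT) (transition_tangent a b).
Proof.
set D := _ @` _; have oD : open D by exact: transition_dom_open.
have oDT := @open_setXT _ 'rV[R]_n 'rV[R]_n _ oD.
have fn := @finite_coords_rV R n.
have Cloc j : Ck_on j D (in_charts a b id) by exact: chart_smooth.
apply: Ck_on_pair => //; last exact: Ck_on_diff.
apply: (@Ck_on_comp _ _ _ _ _ _ D fst) (Cloc k) => //; first by move=> ? [].
exact: Ck_on_fst.
Qed.

(** Open sets are defined by their traces in bundle charts.  This makes the
    inverse charts continuous, and reduces the continuity of the charts to that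
    of the changes of bundle charts. *)
Lemma tangent_atlas Q : is_atlas (tangent Q).
Proof.
have odom (x : Q) : open [set p : tangent Q | cdom (chart_at x) p.1].
  move=> y.
  rewrite [X in open X](_ : _ =
    (cimg (chart_at y) `&` cinv (chart_at y) @^-1` cdom (chart_at x)) `*` setT).
    apply: open_setXT; apply: open_setI_preimage.
    - exact: chart_img_open.
    - by move=> u; exact: chart_inv_continuous.
    - exact: chart_dom_open.
  by apply/seteqP; split=> [[u w] [? ?]|[u w] [[? ?] _]].
split.
- by move=> p; exact: chart_base.
- by move=> p; exact: odom.
- move=> p; rewrite [cimg _]tangent_chart_img; apply: open_setXT.
  exact: chart_img_open.
- by move=> p q; exact: tangent_chartK.
- move=> p q pq P /= /nbhs_interior PO.
  set x := p.1; set O := P°.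
  pose A : set (tangent Q) :=
    [set q : tangent Q | cdom (chart_at x) q.1 /\ O (cfun (tangent_chart x) q)].
  have oA : open A.
    move=> y.
    pose D := cfun (chart_at y) @` (cdom (chart_at y) `&` cdom (chart_at x)).
    rewrite [X in open X](_ : _ =
      (D `*` setT) `&` transition_tangent y x @^-1` O).
      apply: open_setI_preimage.
      - by apply: open_setXT; exact: transition_dom_open.
      - by move=> u Du; apply: Ck_on_continuous (transition_tangent_Ck y x 0) Du.
      - exact: open_interior.
    apply/seteqP; split=> [[u w]|[u w]].
      move=> [/= yu [/= xu Ou]]; split.
        by split=> //=; case: yu xu {Ou} => z yz <-; rewrite chartK // => xz; exists z.
      by rewrite /= -transition_tangentE.
    move=> [[/= [z [yz xz] <-] _] /=].
    have yu : cimg (chart_at y) (cfun (chart_at y) z) by exists z.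
    by rewrite -transition_tangentE //= ?chartK.
  have Aq : A q by split=> //; exact: nbhs_singleton PO.
  apply: filterS (open_nbhs_nbhs (conj oA Aq)) => z [_ Oz].
  exact: interior_subset Oz.
- move=> p [u w]; rewrite [cimg _]tangent_chart_img => -[/= pu _] P.
  rewrite nbhsE => -[A [oA Au] AP].
  have oA' : forall x : Q, open [set v : 'rV[R]_n * 'rV[R]_n |
    cimg (chart_at x) v.1 /\ A (cinv (tangent_chart x) v)] := oA.
  have := oA' p.1; rewrite openE => /(_ (u, w)) /=.
  move=> /(_ (conj pu Au)) h; apply: filterS h => z [_ Az].
  exact: AP.
Qed.

End Tangent.

(** * Tangent maps and the tangent flow *)

Section TangentMap.
Context {R : realType} {n : nat}.
Local Opaque diff.
Variable Q : manifold R n.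
Implicit Types (f g : Q -> Q) (x : Q).

Lemma Ck_rep_near f x (O : set 'rV[R]_n) (F : 'rV[R]_n -> 'rV[R]_n) :
  open O -> O `<=` cimg (chart_at x) ->
  (forall y, setT y -> cdom (chart_at x) y -> O (cfun (chart_at x) y) ->
     cdom (chart_at (f x)) (f y) /\
     cfun (chart_at (f x)) (f y) = F (cfun (chart_at x) y)) ->
  forall u, O u -> \forall v \near u, F v = in_charts x (f x) f v.
Proof.
move=> oO OX rF u Ou; apply: filterS (open_nbhs_nbhs (conj oO Ou)) => v Ov.
have [z xz zv] := OX v Ov; rewrite -zv in Ov *.
by rewrite /in_charts /= chartK //; have [_ ->] := rF z I xz Ov.
Qed.

Lemma mdiff_differentiable f x :
  Ck_rep 1 setT f x -> differentiable (in_charts x (f x) f) (cfun (chart_at x) x).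
Proof.
move=> [ O [F [oO Ox OX CF rF]]].
have [dF _] := CF.
exact: (near_eq_diff (Ck_rep_near oO OX rF Ox) (dF _ Ox)).1.
Qed.

Lemma mdiff_comp f g x v :
  Ck_rep 1 setT f x -> Ck_rep 1 setT g (f x) ->
  mdiff (g \o f) x v = mdiff g (f x) (mdiff f x v).
Proof.
move=> Cf Cg; have aQ := manifold_atlas Q.
have cf := Ck_rep_continuous aQ aQ Cf.
have [_ e] := in_charts_comp (chart_base x) (chart_base (f x)) cf
  (mdiff_differentiable Cf) (mdiff_differentiable Cg).
exact: e.
Qed.

Lemma mdiff_id x v : mdiff (@id Q) x v = v.
Proof. exact: transition_diff_self (chart_base x). Qed.

Lemma tangent_map_comp f g (p : tangent Q) :
  (forall x, Ck_rep 1 setT f x) -> (forall x, Ck_rep 1 setT g x) ->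
  tangent_map (g \o f) p = tangent_map g (tangent_map f p).
Proof.
by move=> Cf Cg; rewrite /tangent_map /=; congr pair; exact: mdiff_comp.
Qed.

Lemma tangent_map_id (p : tangent Q) : tangent_map (@id Q) p = p.
Proof. by case: p => x v; congr pair; exact: mdiff_id. Qed.

(** If [F] represents [f] in the charts at [x] and [f x], then
    [(u, w) |-> (F u, 'd F u w)] represents the tangent map in the bundle
    charts: the preferred charts at the moving points [y] and [f y] cancel by
    the chain rule. *)
Lemma tangent_map_Ck_rep k f (p : tangent Q) :
  (forall x, Ck_rep k.+1 setT f x) ->
  @Ck_rep _ _ _ k (tangent Q) (tangent Q) setT (tangent_map f) p.
Proof.
move=> Cf; case: p => x v.
have C1f y : Ck_rep 1 setT f y by apply: Ck_rep_le (Cf y).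
have aQ := manifold_atlas Q.
have [ O [F [oO Ox OX CF rF]]] := Cf x.
exists (O `*` setT), (fun p => (F p.1, 'd F (p.1) p.2)); split.
- exact: open_setXT.
- by split.
- by rewrite [cimg _]tangent_chart_img => -[u w] [/= Ou _]; split=> //; exact: OX.
- have oOT := @open_setXT _ _ 'rV[R]_n _ oO.
  apply: Ck_on_pair => //; last by apply: Ck_on_diff => //; exact: finite_coords_rV.
  apply: (@Ck_on_comp _ _ _ _ _ _ O fst) (Ck_on_pred CF) => //.
  + exact: finite_coords_rV.
  + by move=> ? [].
  + exact: Ck_on_fst.
- move=> [y w] _ /= xy [/= Oy _].
  have [fxy Fy] := rF y I xy Oy; split; first exact: fxy.
  have yy := chart_base y; have fyy := chart_base (f y).
  rewrite /=.
  apply: (f_equal2 pair).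
    exact: Fy.
  have cf := Ck_rep_continuous aQ aQ (Cf y).
  have dF : differentiable F (cfun (chart_at x) y) by have [+ _] := CF; apply.
  have [dif eqf] := near_eq_diff (Ck_rep_near oO OX rF Oy) dF.
  have cid : {for y, continuous (@id Q)} by move=> ?.
  have [_ e1] := in_charts_comp yy fyy cf (mdiff_differentiable (C1f y))
    (transition_differentiable fyy fxy).
  have [_ e2] := in_charts_comp yy xy cid (transition_differentiable yy xy) dif.
  apply: etrans (esym (e1 w)) _.
  apply: etrans (e2 w) _.
  exact: (congr1 (fun h => h _) eqf).
Qed.

Lemma tangent_map_Ck_map k f :
  (forall x, Ck_rep k.+1 setT f x) ->
  @Ck_map _ _ _ k (tangent Q) (tangent Q) setT (tangent_map f).
Proof.
move=> Cf; split; last by move=> _ p _; exact: tangent_map_Ck_rep.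
have aT := tangent_atlas Q.
apply/within_continuousP => p _ N pN.
have /= := Ck_rep_continuous aT aT (tangent_map_Ck_rep p Cf) pN.
rewrite nbhsE => -[ O [oO Op] ON]; exists O; split=> // q _; exact: ON.
Qed.

End TangentMap.

Section Flow.
Context {R : realType} {n : nat} (Q : manifold R n) (r : nat).
Context (X : Q -> 'rV[R]_n) (Phi : R -> Q -> Q).
Hypothesis r1 : (1 <= r)%N.
Hypothesis flow : is_Cr_flow r X Phi.

(** The time-[t] map is the flow restricted to the slice of time [t]. *)
Lemma flow_Ck_rep t x : Ck_rep r setT (Phi t) x.
Proof.
have aQ := manifold_atlas Q.
have [_ Cflow] := flow_Cr flow.
have fn := @finite_coords_rV R n.
have fRn := finite_coords_prod (@finite_coords_scalar R) fn.
pose j : Q -> prod_charted (euclid R^o) Q := fun y => (t, y).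
apply: (@Ck_rep_comp _ _ _ _ r Q (prod_charted (euclid R^o) Q) Q setT setT j
  (fun p => Phi p.1 p.2) x) => //.
- exact: chart_base.
- exists (cimg (chart_at x)), (fun u => (t, u)); split=> //.
  + exact: chart_img_open.
  + by exists x => //; exact: chart_base.
  + apply: Ck_on_pair.
    * exact: chart_img_open.
    * exact: Ck_on_cst.
    * by apply: (@Ck_on_linear _ _ _ _ _ idfun) => u; exact: cvg_id.
- exact: Cflow.
Qed.

Lemma flow_comp s t : Phi (s + t) = Phi s \o Phi t.
Proof. by apply/funext => x; exact: (flowD flow). Qed.

Lemma flow_id : Phi 0 = id.
Proof. by apply/funext => x; exact: (flow0 flow). Qed.

Lemma flow_Ck_map k t : (k <= r)%N -> Ck_map k setT (Phi t).
Proof.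
move=> kr; have aQ := manifold_atlas Q.
have C x := Ck_rep_le kr (flow_Ck_rep t x).
split; last by move=> _ x _; exact: C.
apply: continuous_subspaceT => x.
exact: (Ck_rep_continuous aQ aQ (C x)).
Qed.

Lemma flow_tangent_Ck_map k t : (k < r)%N ->
  @Ck_map _ _ _ k (tangent Q) (tangent Q) setT (tangent_map (Phi t)).
Proof.
by move=> kr; apply: tangent_map_Ck_map => x; exact: Ck_rep_le kr (flow_Ck_rep t x).
Qed.

Lemma tangent_flow0 (p : tangent Q) : tangent_map (Phi 0) p = p.
Proof. by rewrite flow_id tangent_map_id. Qed.

Lemma tangent_flowD s t (p : tangent Q) :
  tangent_map (Phi (s + t)) p = tangent_map (Phi s) (tangent_map (Phi t) p).
Proof.
by rewrite flow_comp tangent_map_comp // => x; exact: Ck_rep_le r1 (flow_Ck_rep _ x).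
Qed.

End Flow.

(** * The Riemannian norm near the zero section *)
Lemma cvg_sumr (R : realType) (T : Type) (F : set_system T) s
    (f : 'I_s -> T -> R) (l : 'I_s -> R) :
  Filter F -> (forall i, f i x @[x --> F] --> l i) ->
  \sum_i f i x @[x --> F] --> \sum_i l i.
Proof.
by move=> FF cf; apply: cvg_big => [|i _]; [exact: add_continuous|exact: cf].
Qed.

Section QuadraticForms.
Context {R : realType} {n : nat}.
Implicit Types (A B : 'M[R]_n) (v w : 'rV[R]_n).

Lemma ler_entry_norm w i : `|w 0 i| <= `|w|.
Proof.
rewrite -[leRHS]/(mx_norm w) mx_normrE.
exact: (le_bigmax _ (fun ij : 'I_1 * 'I_n => `|w ij.1 ij.2|) (0, i)).
Qed.

Lemma innerE B v w : inner B v w = \sum_i \sum_j v 0 i * B i j * w 0 j.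
Proof.
rewrite /inner !mxE exchange_big /=; apply: eq_bigr => j _.
by rewrite !mxE mulr_suml.
Qed.

Lemma inner_delta B i j : inner B (delta_mx 0 i) (delta_mx 0 j) = B i j.
Proof. by rewrite /inner -rowE trmx_delta -colE !mxE. Qed.

Lemma entry_sub A B i j : (A - B) i j = A i j - B i j.
Proof. by rewrite !mxE. Qed.

Lemma inner_subl A B v w : inner (A - B) v w = inner A v w - inner B v w.
Proof. by rewrite /inner mulmxBr mulmxBl !mxE. Qed.

Lemma innerZ B a w : inner B (a *: w) (a *: w) = a ^+ 2 * inner B w w.
Proof. by rewrite /inner linearZ /= -!scalemxAl -scalemxAr scalerA mxE. Qed.

Lemma inner0 B w : inner B 0 w = 0.
Proof. by rewrite /inner !mul0mx mxE. Qed.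

Lemma inner_lin1 (L : {linear 'rV[R]_n -> 'rV[R]_n}) B v w :
  inner (lin1_mx L *m B *m (lin1_mx L)^T) v w = inner B (L v) (L w).
Proof. by rewrite /inner -!mul_rV_lin1 trmx_mul !mulmxA. Qed.

Lemma ler_inner_entries A w :
  `|inner A w w| <= (\sum_i \sum_j `|A i j|) * `|w| ^+ 2.
Proof.
rewrite innerE mulr_suml; apply: le_trans (ler_norm_sum _ _ _) _.
apply: ler_sum => i _; rewrite mulr_suml; apply: le_trans (ler_norm_sum _ _ _) _.
apply: ler_sum => j _; rewrite !normrM mulrAC [leRHS]mulrC expr2.
by apply: ler_wpM2r => //; apply: ler_pM => //; exact: ler_entry_norm.
Qed.

Lemma inner_continuous B : continuous (fun w => inner B w w : R).
Proof.
have -> : (fun w => inner B w w) = fun w => \sum_i \sum_j w 0 i * B i j * w 0 j.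
  by apply/funext => u; rewrite innerE.
apply: continuous_big => [|i _]; first exact: add_continuous.
apply: continuous_big => [|j _ w]; first exact: add_continuous.
apply: (@cvgM R _ (nbhs w)); last exact: coord_continuous.
apply: (@cvgM R _ (nbhs w)); last exact: cvg_cst.
exact: coord_continuous.
Qed.

(** The form attains a positive minimum on the compact unit sphere.  In dimension
    0 the sphere is empty and any constant will do. *)
Lemma inner_coercive B : (forall w, w != 0 -> 0 < inner B w w) ->
  exists2 c : R, 0 < c & forall w, c * `|w| ^+ 2 <= inner B w w.
Proof.
move=> posB; pose S := [set w : 'rV[R]_n | `|w| = 1].
have [[w0 Sw0]|S0] := pselect (S !=set0); last first.
  exists 1 => // w; have [->|w0] := eqVneq w 0.
    by rewrite normr0 expr0n mulr0 inner0.
  exfalso; apply: S0; exists (`|w|^-1 *: w).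
  by rewrite /S /= normrZ normfV normr_id mulVf ?normr_eq0.
have cS : compact S.
  apply: bounded_closed_compact.
    exists 1; split; first exact: num_real.
    by move=> x x1 w Sw; rewrite /= Sw ltW.
  rewrite (_ : S = (fun w => `|w|) @^-1` [set x | x = 1 :> R]) //.
  apply: preimage_closed; last exact: closed_eq.
  by move=> w _; exact: norm_continuous.
have [//||w1 Sw1 minw1] :=
  @EVT_min_rV R n (fun w => inner B w w) S _ cS.
- by exists w0.
- by apply: continuous_subspaceT; exact: inner_continuous.
have w1n0 : w1 != 0.
  by rewrite -normr_eq0; move: Sw1; rewrite inE /S /= => ->; rewrite oner_eq0.
exists (inner B w1 w1); first exact: posB.
move=> w; have [->|w0'] := eqVneq w 0.
  by rewrite normr0 expr0n mulr0 inner0.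
have nw : 0 < `|w| by rewrite normr_gt0.
have := minw1 (`|w|^-1 *: w).
rewrite inE /S /= normrZ normfV normr_id mulVf ?gt_eqF // => /(_ erefl).
by rewrite innerZ exprVn mulrC ler_pdivlMr // exprn_gt0.
Qed.

End QuadraticForms.

Section Metric.
Context {R : realType} {n : nat} (Q : manifold R n) (g : riemannian Q).
Local Opaque diff.

(** The matrix [g q] refers to the preferred chart at [q], which may vary wildly
    with [q]; congruence by the change of charts expresses the metric in the one
    chart at [m], where its coefficients are continuous. *)
Definition gram (m : Q) (u : 'rV[R]_n) : 'M[R]_n :=
  let P := lin1_mx
    ('d (cfun (chart_at (cinv (chart_at m) u)) \o cinv (chart_at m)) u) in
  P *m g (cinv (chart_at m) u) *m P^T.

Lemma gramE m u v w : inner (gram m u) v w =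
  inner (g (cinv (chart_at m) u)) (cinv (tangent_chart m) (u, v)).2
    (cinv (tangent_chart m) (u, w)).2.
Proof. exact: inner_lin1. Qed.

Lemma gram_base_pos m w : w != 0 -> 0 < inner (gram m (cfun (chart_at m) m)) w w.
Proof.
move=> w0; have mm := chart_base m.
rewrite gramE /= chartK //.
have -> : 'd (cfun (chart_at m) \o cinv (chart_at m)) (cfun (chart_at m) m) w = w.
  exact: transition_diff_self mm.
exact: metric_pos.
Qed.

Lemma gram_continuous m i j :
  {for cfun (chart_at m) m, continuous (fun u => gram m u i j : R)}.
Proof.
have := @metric_smooth R n Q g m (delta_mx 0 i) (delta_mx 0 j) 0.
move=> /(_ (cfun (chart_at m) m)) h.
have -> : (fun u => gram m u i j) = (fun u => inner (g (cinv (chart_at m) u))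
   (cinv (tangent_chart m) (u, delta_mx 0 i)).2
   (cinv (tangent_chart m) (u, delta_mx 0 j)).2).
  by apply/funext => u; rewrite -inner_delta gramE.
by apply: h; exists m => //; exact: chart_base.
Qed.

(** Half of the coercivity constant at [m] survives wherever the coefficients of
    the metric have moved by less than that half in total. *)
Lemma gram_coercive m : exists2 c : R, 0 < c &
  \forall u \near cfun (chart_at m) m,
    forall w, c * `|w| ^+ 2 <= inner (gram m u) w w.
Proof.
set u0 := cfun _ _.
have [c c0 cw] := inner_coercive (@gram_base_pos m).
have half_bound (a b y z : R) :
    c * z <= b -> - y <= a - b -> y <= c / 2 * z -> c / 2 * z <= a by lra.
exists (c / 2); first exact: divr_gt0.
pose s (u : 'rV[R]_n) : R := \sum_i \sum_j `|(gram m u - gram m u0) i j|.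
have cs : s u @[u --> u0] --> s u0.
  apply: (@cvg_sumr R _ (nbhs u0)) => i; apply: (@cvg_sumr R _ (nbhs u0)) => j.
  apply: (@cvg_norm _ _ _ (nbhs u0)).
  rewrite (_ : (fun u => _) = fun u => gram m u i j - gram m u0 i j); last first.
    by apply/funext => u; rewrite entry_sub.
  rewrite entry_sub.
  by apply: (@cvgB _ _ _ (nbhs u0)); [exact: gram_continuous|exact: cvg_cst].
have s0 : s u0 = 0.
  by rewrite /s big1 // => i _; rewrite big1 // => j _; rewrite entry_sub subrr normr0.
have : \forall u \near u0, s u < c / 2.
  have c20 : s u0 < c / 2 by rewrite s0 divr_gt0.
  exact: (cvgr_lt _ cs _ c20).
apply: filterS => u su w.
have close : - (s u * `|w| ^+ 2) <= inner (gram m u) w w - inner (gram m u0) w w.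
  by have := ler_inner_entries (gram m u - gram m u0) w;
    rewrite inner_subl ler_norml => /andP[].
have small : s u * `|w| ^+ 2 <= c / 2 * `|w| ^+ 2.
  by rewrite ler_wpM2r ?sqr_ge0 // ltW.
exact: (half_bound _ _ _ _ (cw w) close small).
Qed.

Lemma tnorm_ge0 m v : 0 <= tnorm g m v.
Proof. exact: sqrtr_ge0. Qed.

Lemma tnorm_sqr m v : tnorm g m v ^+ 2 = inner (g m) v v.
Proof.
rewrite sqr_sqrtr //; have [->|v0] := eqVneq v 0; first by rewrite inner0.
exact/ltW/metric_pos.
Qed.

Lemma tnorm_eq0 m v : tnorm g m v = 0 -> v = 0.
Proof.
move=> v0; apply/eqP; apply/contraT => /(metric_pos g m).
by rewrite -tnorm_sqr v0 expr0n ltxx.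
Qed.

Lemma tnormZ m a v : tnorm g m (a *: v) = `|a| * tnorm g m v.
Proof. by rewrite /tnorm innerZ sqrtrM ?sqr_ge0 // sqrtr_sqr. Qed.

(** The link between the Riemannian norm, in which the rates of contraction are
    given, and the topology of the tangent bundle. *)
Lemma short_vectors_nbhs (m : Q) (O : set (tangent Q)) :
  open O -> O (m, 0) ->
  exists (N : set Q) (eps : R), [/\ nbhs m N, 0 < eps &
    forall q w, N q -> tnorm g q w < eps -> O (q, w)].
Proof.
move=> oO Om; have mm := chart_base m.
have oD : forall x : Q, open [set v : 'rV[R]_n * 'rV[R]_n |
    cimg (chart_at x) v.1 /\ O (cinv (tangent_chart x) v)] := oO.
set u0 := cfun (chart_at m) m.
have : nbhs (u0, (0 : 'rV[R]_n)) [set v : 'rV[R]_n * 'rV[R]_n |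
    cimg (chart_at m) v.1 /\ O (cinv (tangent_chart m) v)].
  apply: open_nbhs_nbhs; split=> //=; split; first by exists m.
  by rewrite /u0 chartK // linear0.
move=> [[A B] /= [Au0 B0] AB].
have /nbhs_ballP[e /= e0 eB] := B0.
have [c c0 near_c] := gram_coercive m.
(* A vector of length at least e would have squared norm at least c e^2. *)
exists (cdom (chart_at m) `&`
  cfun (chart_at m) @^-1` (A `&` [set u | forall w, c * `|w| ^+ 2 <= inner (gram m u) w w])),
  (Num.sqrt (c * e ^+ 2)); split.
- apply: filterI; first exact: near_chart_dom.
  apply: (near_chart_fun mm); apply: filterI; first exact: Au0.
  exact: near_c.
- by rewrite sqrtr_gt0 mulr_gt0 // exprn_gt0.
- move=> q w [mq [Aq cq]] wlt.
  rewrite -(tangent_chartK (p := (q, w) : tangent Q) mq).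
  set p := cfun (tangent_chart m) _.
  have [_] : [set v : 'rV[R]_n * 'rV[R]_n |
    cimg (chart_at m) v.1 /\ O (cinv (tangent_chart m) v)] p; last by [].
  apply: AB; split; first exact: Aq.
  apply: eB; rewrite -ball_normE /= sub0r normrN ltNge; apply/negP => ep.
  move: wlt; apply/negP; rewrite -leNgt.
  have ip : inner (gram m p.1) p.2 p.2 = inner (g q) w w.
    rewrite gramE -(surjective_pairing p).
    have -> : cinv (tangent_chart m) p = (q, w) by exact: tangent_chartK.
    by rewrite /= chartK.
  rewrite ler_wsqrtr // -ip; apply: le_trans (cq p.2).
  by rewrite ler_pM2l // ler_sqr ?nnegrE // ltW.
Qed.

End Metric.

(** * Globalizing the local conjugacy *)

Section Linearization.
Context {R : realType} {n d r k : nat} (Q : manifold R n) (g : riemannian Q).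
Context (X : Q -> 'rV[R]_n) (Phi : R -> Q -> Q).
Context (M : set Q) (E : Q -> {vspace 'rV[R]_n}) (Wloc : Q -> set Q).
Context (U : set Q) (phi_loc : Q -> tangent Q).
Hypothesis r1 : (1 <= r)%N.
Hypothesis kr : (k < r)%N.
Hypothesis flow : is_Cr_flow r X Phi.
Hypothesis naim : is_1NAIM g Phi d M E.
Hypothesis stable : is_local_stable_manifold r d Phi M E Wloc.
Hypothesis lconj : is_local_conjugacy k Phi M E Wloc U phi_loc.

Local Notation W := (WsM Phi M Wloc).
Local Notation TPhi t := (tangent_map (Phi t)).

Lemma invariant_flow t m : M m -> M (Phi t m).
Proof. by move=> Mm; rewrite -(naim_invariant naim t); exists m. Qed.

Lemma flowK t x : Phi (- t) (Phi t x) = x.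
Proof. by rewrite -(flowD flow) addNr (flow0 flow). Qed.

Lemma tangent_flowK t (p : tangent Q) : TPhi (- t) (TPhi t p) = p.
Proof. by rewrite -(tangent_flowD r1 flow) addNr (tangent_flow0 flow). Qed.

Lemma total_space_flow t (p : tangent Q) :
  total_space M E p -> total_space M E (TPhi t p).
Proof.
move=> [Mp Ep]; split; first exact: invariant_flow.
suff : [set` E (Phi t p.1)] (mdiff (Phi t) p.1 p.2) by [].
by rewrite -(naim_bundle_invariant naim t Mp); exists p.2.
Qed.

Lemma Ws_flow t m x : M m -> Ws Phi Wloc m x -> Ws Phi Wloc (Phi t m) (Phi t x).
Proof.
move=> Mm [s /= s0 [y Wy <-]].
have [ts|st] := leP t s.
  exists (s - t); first by rewrite /= subr_ge0.
  exists y; first by rewrite -(flowD flow) subrK.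
  by rewrite -(flowD flow) opprB.
exists 0; first exact: (lexx (0 : R)).
exists (Phi (t - s) y); last by rewrite oppr0 -!(flowD flow) add0r.
rewrite (flow0 flow); have -> : Phi t m = Phi (t - s) (Phi s m).
  by rewrite -(flowD flow) subrK.
apply: (Wloc_invariant stable); [exact: invariant_flow| |by exists y].
by rewrite subr_ge0 ltW.
Qed.

Lemma W_flow t x : W x -> W (Phi t x).
Proof.
move=> [m Mm Wx]; exists (Phi t m); first exact: invariant_flow.
exact: Ws_flow.
Qed.

Lemma dom_sub_W : U `<=` W.
Proof. by have [ O _ ->] := conj_dom_open lconj; exact: subIsetl. Qed.

Lemma dom_open : open U.
Proof.
by have [ O oO ->] := conj_dom_open lconj; apply: openI => //; exact: WsM_open stable.
Qed.

Lemma W_enters_dom x : W x -> \forall t \near +oo, U (Phi t x).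
Proof.
rewrite (WsM_basin stable); apply.
by apply/set_nbhsP; exists U; split; [exact: dom_open|exact: conj_dom_nbhs lconj|].
Qed.

Lemma W_enters_domP x : W x -> exists t, U (Phi t x).
Proof. by move=> /W_enters_dom Ux; exact: filter_ex Ux. Qed.

(** The rates for [i = 0], where the factor coming from the conorm is 1. *)
Lemma fiber_contraction : exists C a : R, [/\ 0 < C, a < 0 &
  forall m t v, M m -> 0 <= t -> v \in E m ->
    tnorm g (Phi t m) (mdiff (Phi t) m v) <= C * expR (a * t) * tnorm g m v].
Proof.
have [C [a [C0 a0 rate]]] := naim_rates naim.
exists C, a; split=> // m t v Mm t0 Ev.
have [|v0] := eqVneq (tnorm g m v) 0.
  move=> v0; rewrite v0 (tnorm_eq0 v0) mulr0.
  by rewrite /mdiff linear0 /tnorm inner0 sqrtr0.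
have vpos : 0 < tnorm g m v by rewrite lt0r v0 tnorm_ge0.
pose u := (tnorm g m v)^-1 *: v.
have Eu : u \in E m by rewrite memvZ.
have u1 : tnorm g m u = 1.
  by rewrite tnormZ ger0_norm ?invr_ge0 ?tnorm_ge0 // mulVf.
have := rate m t 0%N Mm t0 isT; rewrite expe0 mule1 => op.
have : ((tnorm g (Phi t m) (mdiff (Phi t) m u))%:E <=
        (C * expR (a * t))%:E)%E.
  apply: le_trans op; apply: ereal_sup_ubound.
  by exists u => //; split=> //; rewrite u1.
rewrite lee_fin /u /mdiff linearZ -/(mdiff _ _ _) tnormZ.
rewrite ger0_norm ?invr_ge0 ?tnorm_ge0 //.
by rewrite mulrC ler_pdivrMr.
Qed.

Lemma exp_decay (C a s e : R) : a < 0 -> 0 < C -> 0 <= s -> 0 < e ->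
  \forall t \near +oo, C * expR (a * t) * s < e.
Proof.
move=> a0 C0 s0 e0; near=> t.
have t0 : 0 < - a * t.
  by rewrite mulr_gt0 ?oppr_gt0 //; near: t; apply: nbhs_pinfty_gt; exact: num_real.
have big : C * s / e < - a * t.
  rewrite [ltRHS]mulrC -ltr_pdivrMr ?oppr_gt0 //; near: t.
  by apply: nbhs_pinfty_gt; exact: num_real.
have eb : - a * t <= expR (- a * t).
  by apply: le_trans (expR_ge1Dx _); rewrite lerDr.
have -> : a * t = - (- a * t) by rewrite mulNr opprK.
rewrite expRN mulrAC ltr_pdivrMr ?expR_gt0 // [ltRHS]mulrC -ltr_pdivrMr //.
exact: lt_le_trans big eb.
Unshelve. all: by end_near.
Qed.

(** Instead of a tube of uniform radius around the zero section, take a point [m']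
    of the compact [M] at which the orbit of the base point accumulates, and wait
    for a late time at which the base point is close to [m'] and the vector is
    short. *)
Lemma total_space_enters (O : set (tangent Q)) (p : tangent Q) :
  open O -> (forall m, M m -> O (m, 0)) -> total_space M E p ->
  exists t, O (TPhi t p).
Proof.
case: p => m v oO Om [/= Mm Ev].
have [C [a [C0 a0 contr]]] := fiber_contraction.
pose F : set_system Q := Phi^~ m @ +oo.
have FF : ProperFilter F by apply: fmap_proper_filter; exact: proper_pinfty_nbhs.
have FM : \forall t \near +oo, M (Phi t m) by near=> t; exact: invariant_flow.
have [m' [Mm' clm']] := naim_compact naim FF FM.
have [N [eps [Nm' eps0 NO]]] := short_vectors_nbhs g oO (Om _ Mm').
pose A := [set q | exists t, [/\ 0 <= t, q = Phi t m &
  C * expR (a * t) * tnorm g m v < eps]].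
have FA : \forall t \near +oo, A (Phi t m).
  near=> t; exists t; split=> //.
  near: t; apply: exp_decay => //; exact: tnorm_ge0.
have [_ [[t [t0 -> small]] Nq]] := clm' _ _ FA Nm'.
exists t; apply: NO => //=; apply: le_lt_trans small.
exact: contr.
Unshelve. all: by end_near.
Qed.

Lemma total_space_enters_image (p : tangent Q) :
  total_space M E p -> exists t, (phi_loc @` U) (TPhi t p).
Proof.
move=> Tp; have [ O oO eO] := conj_img_open lconj.
have [|t Ot] := total_space_enters oO _ Tp.
  by move=> m /(conj_img_zero lconj); rewrite eO => -[].
by exists t; rewrite eO; split=> //; exact: total_space_flow.
Qed.

(** Any time at which the orbit is in [U]; the choice is immaterial by
    [global_conjE]. *)
Definition entry_time (x : Q) : R := xget 0 [set t | U (Phi t x)].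

Definition global_conj (x : Q) : tangent Q :=
  TPhi (- entry_time x) (phi_loc (Phi (entry_time x) x)).

(** The local conjugacy relation links any two points of [U] on the same orbit,
    wherever the orbit passes in between. *)
Lemma global_conjE t x : U (Phi t x) -> global_conj x = TPhi (- t) (phi_loc (Phi t x)).
Proof.
move=> Ut; rewrite /global_conj; set s := entry_time x.
have Us : U (Phi s x) by exact: (@xgetI _ _ [set t | U (Phi t x)] t).
have e : Phi s x = Phi (s - t) (Phi t x) by rewrite -(flowD flow) subrK.
rewrite e (conj_eq lconj) -?e // -(tangent_flowD r1 flow).
by congr (tangent_map (Phi _) _); rewrite addrA addNr add0r.
Qed.

Lemma global_conj_dom x : U x -> global_conj x = phi_loc x.
Proof.
move=> Ux; rewrite (@global_conjE 0) ?(flow0 flow) //.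
by rewrite oppr0 (tangent_flow0 flow).
Qed.

Lemma global_conj_flow t x : W x -> global_conj (Phi t x) = TPhi t (global_conj x).
Proof.
move=> /(W_flow t)/W_enters_domP[s Us]; rewrite (global_conjE Us).
have Ust : U (Phi (s + t) x) by rewrite (flowD flow).
rewrite (global_conjE Ust) -(tangent_flowD r1 flow) (flowD flow).
by congr (tangent_map (Phi _) _); rewrite opprD addrCA addrN addr0.
Qed.

Lemma global_conj_fiber : fiber_preserving Phi M E Wloc W global_conj.
Proof.
move=> m x Mm Wx Wsx; have [t Ut] := W_enters_domP Wx.
have Mt := invariant_flow t Mm.
have [e1 e2] := conj_fiber lconj Mt Ut (Ws_flow t Mm Wsx).
have Tp : total_space M E (phi_loc (Phi t x)) by split; rewrite e1.
have [_ Ep] := total_space_flow (- t) Tp.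
rewrite (global_conjE Ut); split; first by rewrite /= e1 flowK.
by move: Ep; rewrite [in E _]/= e1 flowK.
Qed.

Lemma global_conj_total x : W x -> total_space M E (global_conj x).
Proof.
move=> Wx; have [m Mm Wsx] := Wx.
by have [e1 e2] := global_conj_fiber Mm Wx Wsx; split; rewrite e1.
Qed.

(** Two points with the same image are carried into [U] by a common late time,
    where [phi_loc] separates them. *)
Lemma global_conj_inj x y : W x -> W y -> global_conj x = global_conj y -> x = y.
Proof.
move=> Wx Wy exy.
have [_ _ [h [hK _]]] := conj_iso lconj.
have [t [Utx Uty]] : exists t, U (Phi t x) /\ U (Phi t y).
  exact: (@filter_ex _ _ _ _ (filterI (W_enters_dom Wx) (W_enters_dom Wy))).
rewrite -[x](flowK t) -[y](flowK t); congr (Phi _ _).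
rewrite -(hK _ Utx) -(hK _ Uty); congr h.
by rewrite -(global_conj_dom Utx) -(global_conj_dom Uty) !global_conj_flow // exy.
Qed.

Lemma global_conj_backward t y : U y -> global_conj (Phi (- t) y) = TPhi (- t) (phi_loc y).
Proof. by move=> Uy; rewrite global_conj_flow ?global_conj_dom //; exact: dom_sub_W. Qed.

(** A vector is carried into the image of [phi_loc] by the tangent flow, lifted
    to [U] there, and brought back by the flow. *)
Lemma global_conj_image : global_conj @` W = total_space M E.
Proof.
apply/seteqP; split=> [_ [x Wx <-]|p Tp]; first exact: global_conj_total.
have [t [y Uy ey]] := total_space_enters_image Tp.
exists (Phi (- t) y); first by apply: W_flow; exact: dom_sub_W.
by rewrite global_conj_backward // ey tangent_flowK.
Qed.

(** The base point only serves as a default value off the total space. *)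
Definition global_conj_inv (p : tangent Q) : Q := xget p.1 [set x | W x /\ global_conj x = p].

Lemma global_conjK x : W x -> global_conj_inv (global_conj x) = x.
Proof.
move=> Wx.
have [Wz ez] : [set z | W z /\ global_conj z = global_conj x] (global_conj_inv (global_conj x)).
  by apply: (@xgetI _ _ _ x); split.
exact: global_conj_inj.
Qed.

Lemma finite_coords_rVrV : finite_coords ('rV[R]_n * 'rV[R]_n)%type.
Proof. by apply: finite_coords_prod; exact: finite_coords_rV. Qed.

(** A time that brings [x] into the open set [U] also works for the points near
    [x].  The loss of one derivative in the tangent flow is where [k < r] is
    needed. *)
Lemma global_conj_Ck : Ck_map k W global_conj.
Proof.
have [_ Cloc _] := conj_iso lconj.
apply: Ck_map_local; first exact: manifold_atlas.
move=> x Wx; have [t Ut] := W_enters_domP Wx.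
exists (Phi t @^-1` U), (TPhi (- t) \o (phi_loc \o Phi t)); split.
- rewrite -[_ @^-1` _]setTI; apply: open_setI_preimage dom_open => //.
    exact: openT.
  have aQ := manifold_atlas Q.
  by move=> y _; exact: (Ck_rep_continuous aQ aQ (flow_Ck_rep r1 flow t y)).
- exact: Ut.
- by move=> y _ Uy; rewrite (global_conjE Uy).
- apply: (@Ck_map_comp _ _ _ _ k Q (tangent Q) (tangent Q) _ setT) => //.
  + exact: finite_coords_rV.
  + exact: finite_coords_rVrV.
  + exact: chart_base.
  + apply: (@Ck_map_comp _ _ _ _ k Q Q (tangent Q) _ U) => //.
    * exact: finite_coords_rV.
    * exact: finite_coords_rV.
    * exact: chart_base.
    * by move=> y [].
    * by apply: Ck_map_sub (flow_Ck_map r1 flow t (ltnW kr)).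
  + exact: (flow_tangent_Ck_map r1 flow (- t) kr).
Qed.

(** Likewise, near [p] the inverse is [Phi (- t) \o h \o TPhi t] for one time [t],
    [h] being the inverse of [phi_loc]. *)
Lemma global_conj_inv_Ck : Ck_map k (total_space M E) global_conj_inv.
Proof.
have [_ _ [h [hK Ch]]] := conj_iso lconj.
have [ O oO eO] := conj_img_open lconj.
have aT := tangent_atlas Q.
apply: Ck_map_local; first exact: aT.
move=> p Tp; have [t imt] := total_space_enters_image Tp.
exists (TPhi t @^-1` O), (Phi (- t) \o (h \o TPhi t)); split.
- rewrite -[_ @^-1` _]setTI; apply: open_setI_preimage oO => //.
    exact: openT.
  move=> q _; apply: (Ck_rep_continuous aT aT (k := 0)).
  by apply: tangent_map_Ck_rep => x; exact: Ck_rep_le r1 (flow_Ck_rep r1 flow t x).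
- by move: imt; rewrite eO => -[].
- move=> q Tq Oq.
  have [y Uy ey] : (phi_loc @` U) (TPhi t q).
    by rewrite eO; split=> //; exact: total_space_flow.
  rewrite /= -ey hK // -[in LHS](tangent_flowK t q) -ey -global_conj_backward //.
  by rewrite global_conjK //; apply: W_flow; exact: dom_sub_W.
- apply: (@Ck_map_comp _ _ _ _ k (tangent Q) Q Q _ setT) => //.
  + exact: finite_coords_rVrV.
  + exact: finite_coords_rV.
  + exact: (atlas_base aT).
  + apply: (@Ck_map_comp _ _ _ _ k (tangent Q) (tangent Q) Q _ (phi_loc @` U)) => //.
    * exact: finite_coords_rVrV.
    * exact: finite_coords_rVrV.
    * exact: (atlas_base aT).
    * by move=> q [Tq Oq]; rewrite eO; split=> //; exact: total_space_flow.
    * by apply: Ck_map_sub (flow_tangent_Ck_map r1 flow t kr).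
  + exact: (flow_Ck_map r1 flow (- t) (ltnW kr)).
Qed.

Lemma global_conj_iso : Ck_iso k W (total_space M E) global_conj.
Proof.
split; [exact: global_conj_image|exact: global_conj_Ck|exists global_conj_inv; split].
  exact: global_conjK.
exact: global_conj_inv_Ck.
Qed.

End Linearization.

Unset Implicit Arguments.
Set Strict Implicit.
Set Printing Implicit Defensive.

Theorem theorem2 (R : realType) (n d r k : nat)
    (Q : manifold R n) (g : riemannian Q)
    (X : Q -> 'rV[R]_n) (Phi : R -> Q -> Q)
    (M : set Q) (E : Q -> {vspace 'rV[R]_n}) (Wloc : Q -> set Q)
    (U : set Q) (phi_loc : Q -> tangent Q) :
  (1 <= r)%N ->
  is_Cr_flow r X Phi ->
  is_1NAIM g Phi d M E ->
  is_local_stable_manifold r d Phi M E Wloc ->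
  (0 <= k <= r - 1)%N ->
  is_Ck_subbundle k d M E ->
  is_local_conjugacy k Phi M E Wloc U phi_loc ->
  exists phi : Q -> tangent Q,
    [/\ Ck_iso k (WsM Phi M Wloc) (total_space M E) phi,
        fiber_preserving Phi M E Wloc (WsM Phi M Wloc) phi,
        forall t x, WsM Phi M Wloc x ->
          phi (Phi t x) = tangent_map (Phi t) (phi x) &
        forall x, U x -> phi x = phi_loc x].
Proof.
move=> r1 flow naim stable /andP[_ kr1] _ lconj.
have kr : (k < r)%N by rewrite -(subnK r1) addn1 ltnS.
exists (global_conj Phi U phi_loc); split.
- exact: (global_conj_iso r1 kr flow naim stable lconj).
- exact: (global_conj_fiber r1 flow naim stable lconj).
- by move=> t x; exact: (global_conj_flow r1 flow naim stable lconj).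
- by move=> x; exact: (global_conj_dom r1 flow lconj).
Qed.
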